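(* Let $f=h+\overline{g}$, with $$h(z)=\sum_{n=0}^{\infty}a_nz^n,\qquad g(z)=\sum_{n=1}^{\infty}b_nz^n,\qquad z\in\mathbb{D},$$ be a sense-preserving harmonic mapping in $\mathbb{D}$, and suppose that $h(z)-h(0)\prec_q\varphi(z)-\varphi(0)$ in $\mathbb{D}$, where $\varphi$ is analytic, univalent and convex in $\mathbb{D}$. Let $\lambda=\mathrm{dist}\,(\varphi(0),\partial\varphi(\mathbb{D}))$ and assume $\lambda<1$. Put $\|f_0\|_r=\sum_{n=1}^{\infty}(|a_n|^2+|b_n|^2)r^{2n}$ and $$T_f(r):=\sum_{n=1}^{\infty}(|a_n|+|b_n|)r^n+\left(\frac{1}{2-\lambda}+\frac{r}{1-r}\right)\|f_0\|_r .$$ Then $T_f(r)\le\lambda$ for $0\le r\le r_*$, where $r_*\approx0.15867508$ is the unique root in $(0,1)$ of the equation $$5r^3-9r^2-5r+1=0.$$ Moreover, for any $\lambda\in(0,1)$ there exists a uniquely defined $r_0=r_0(\lambda)\in(r_*,\frac15)$ such that $T_f(r)\le\lambda$ for $r\in[0,r_0]$ (for every analytic, univalent and convex function $\varphi$ in $\mathbb{D}$ with $\mathrm{dist}(\varphi(0),\partial\varphi(\mathbb{D}))=\lambda$ and every sense-preserving harmonic mapping $f=h+\overline{g}$ in $\mathbb{D}$ with $h(z)=\sum_{n=0}^{\infty}a_nz^n$, $g(z)=\sum_{n=1}^{\infty}b_nz^n$ and $h(z)-h(0)\prec_q\varphi(z)-\varphi(0)$ in $\mathbb{D}$); namely, $r_0$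 is the unique solution $r\in(r_*,\frac15)$ of the equation $$8r^3\lambda^2-(13r^3+7r^2-5r+1)\lambda+10r^3-2r^2-10r+2=0.$$
   Context: $\mathbb{D}=\{z\in\mathbb{C}:|z|<1\}$. $\mathcal{B}$ is the class of analytic functions $\omega$ in $\mathbb{D}$ with $|\omega(z)|\le1$ for all $z\in\mathbb{D}$, and $\mathcal{B}_0=\{\omega\in\mathcal{B}:\omega(0)=0\}$. For analytic $F,G$ in $\mathbb{D}$, $F$ is quasi-subordinate to $G$, written $F\prec_qG$, if there exist $\Phi\in\mathcal{B}$ and $\omega\in\mathcal{B}_0$ such that $F(z)=\Phi(z)G(\omega(z))$ for $z\in\mathbb{D}$. A harmonic mapping $f$ of $\mathbb{D}$ is a complex-valued function satisfying $\Delta f=0$; it can be written $f=h+\overline{g}$ with $h,g$ analytic in $\mathbb{D}$, here normalized by $g(0)=0$. It is sense-preserving in $\mathbb{D}$ if its Jacobian $J_f=|h'|^2-|g'|^2$ is positive in $\mathbb{D}$. An analytic univalent function $\varphi$ in $\mathbb{D}$ is called convex if $\varphi(\mathbb{D})$ is a convex domain. $\mathrm{dist}(\varphi(0),\partial\varphi(\mathbb{D}))$ is the Euclidean distance from $\varphi(0)$ to the boundary of $\varphi(\mathbb{D})$. The symbol $f_0$ denotes $f-f(0)$. *)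

(* Defs.v *)
From Stdlib Require Import Reals.
From Coquelicot Require Import Coquelicot.
Open Scope R_scope.

Definition disk (z : C) : Prop := Cmod z < 1.

(* Coefficients of a power series are indexed from 0: [c 0] is the constant
   term. *)
Definition power_series_sum (c : nat -> C) (z l : C) : Prop :=
  @is_pseries C_AbsRing C_NormedModule c z l.

Definition analytic_at (F : C -> C) (z0 : C) : Prop :=
  exists (c : nat -> C) (rho : posreal),
    forall z : C, Cmod (z - z0) < rho -> power_series_sum c (z - z0) (F z).

(* Functions on the disk are total functions C -> C; their values outside the
   disk are unconstrained. *)
Definition analytic (F : C -> C) : Prop :=
  forall z : C, disk z -> analytic_at F z.

Definition class_B (w : C -> C) : Prop :=
  analytic w /\ forall z : C, disk z -> Cmod (w z) <= 1.

Definition class_B0 (w : C -> C) : Prop :=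
  class_B w /\ w (RtoC 0) = RtoC 0.

(* By the Schwarz lemma [w z] stays in the disk, so only values of [G] in the
   disk matter. *)
Definition quasi_subordinate (F G : C -> C) : Prop :=
  exists Phi w : C -> C, class_B Phi /\ class_B0 w /\
    forall z : C, disk z -> F z = Cmult (Phi z) (G (w z)).

Definition dx (u : C -> R) (z : C) : R := Derive (fun t => u (t, Im z)) (Re z).
Definition dy (u : C -> R) (z : C) : R := Derive (fun t => u (Re z, t)) (Im z).

Definition continuously_differentiable (u : C -> R) : Prop :=
  forall z : C, disk z ->
    ex_derive (fun t : R => u (t, Im z)) (Re z) /\
    ex_derive (fun t : R => u (Re z, t)) (Im z) /\
    continuous (dx u) z /\ continuous (dy u) z.

Definition real_harmonic (u : C -> R) : Prop :=
  continuously_differentiable u /\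
  continuously_differentiable (dx u) /\ continuously_differentiable (dy u) /\
  forall z : C, disk z -> dx (dx u) z + dy (dy u) z = 0.

Definition harmonic (f : C -> C) : Prop :=
  real_harmonic (fun z => Re (f z)) /\ real_harmonic (fun z => Im (f z)).

(* The Jacobian of h + conj g. *)
Definition jacobian (h g : C -> C) (z : C) : R :=
  Cmod (C_derive h z) ^ 2 - Cmod (C_derive g z) ^ 2.

Definition sense_preserving (h g : C -> C) : Prop :=
  forall z : C, disk z -> 0 < jacobian h g z.

(* [f = h + conj g] with [h z = sum_{n>=0} a n z^n] and
   [g z = sum_{n>=1} b n z^n] throughout the disk.  Harmonicity follows from
   the decomposition; it is listed because it is what the name asserts. *)
Definition sense_preserving_harmonic_mapping
    (f h g : C -> C) (a b : nat -> C) : Prop :=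
  harmonic f /\
  (forall z : C, disk z -> f z = Cplus (h z) (Cconj (g z))) /\
  (forall z : C, disk z -> power_series_sum a z (h z)) /\
  (forall z : C, disk z -> power_series_sum b z (g z)) /\
  b 0%nat = RtoC 0 /\
  sense_preserving h g.

Definition univalent (F : C -> C) : Prop :=
  forall z1 z2 : C, disk z1 -> disk z2 -> F z1 = F z2 -> z1 = z2.

Definition disk_image (F : C -> C) (w : C) : Prop :=
  exists z : C, disk z /\ F z = w.

Definition convex_set (S : C -> Prop) : Prop :=
  forall (u v : C) (t : R), S u -> S v -> 0 <= t <= 1 ->
    S (Cplus (Cmult (RtoC (1 - t)) u) (Cmult (RtoC t) v)).

(* The image is automatically a domain, by the open mapping theorem. *)
Definition convex_univalent (F : C -> C) : Prop :=
  analytic F /\ univalent F /\ convex_set (disk_image F).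

Definition boundary (S : C -> Prop) (w : C) : Prop :=
  forall eps : posreal,
    (exists z : C, Cmod (z - w) < eps /\ S z) /\
    (exists z : C, Cmod (z - w) < eps /\ ~ S z).

(* Extended-real valued: the distance to the empty set is [p_infty]. *)
Definition dist_to (z : C) (S : C -> Prop) : Rbar :=
  Glb_Rbar (fun d : R => exists w : C, S w /\ d = Cmod (z - w)).

(* [||f_0||_r]; the index is shifted so that the sum starts at [n = 1].  For the
   coefficients of functions analytic in the disk and [0 <= r < 1], this series
   and the one in [T] converge, so [Series] is their actual sum. *)
Definition norm_f0 (a b : nat -> C) (r : R) : R :=
  Series (fun n => (Cmod (a (S n)) ^ 2 + Cmod (b (S n)) ^ 2) * r ^ (2 * S n)).

Definition T (a b : nat -> C) (lambda r : R) : R :=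
  Series (fun n => (Cmod (a (S n)) + Cmod (b (S n))) * r ^ S n)
  + (1 / (2 - lambda) + r / (1 - r)) * norm_f0 a b r.

Definition admissible (phi f h g : C -> C) (a b : nat -> C) (lambda : R)
    : Prop :=
  sense_preserving_harmonic_mapping f h g a b /\
  convex_univalent phi /\
  quasi_subordinate (fun z => Cminus (h z) (h (RtoC 0)))
                    (fun z => Cminus (phi z) (phi (RtoC 0))) /\
  dist_to (phi (RtoC 0)) (boundary (disk_image phi)) = Finite lambda.

Definition rstar_equation (r : R) : Prop :=
  5 * r ^ 3 - 9 * r ^ 2 - 5 * r + 1 = 0.

Definition r0_equation (lambda r : R) : Prop :=
  8 * r ^ 3 * lambda ^ 2 - (13 * r ^ 3 + 7 * r ^ 2 - 5 * r + 1) * lambda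
  + 10 * r ^ 3 - 2 * r ^ 2 - 10 * r + 2 = 0.

(* Main.v *)
Require Import Defs.
From Stdlib Require Import Reals Lra Lia Classical ClassicalEpsilon.
From Coquelicot Require Import Coquelicot.
Open Scope R_scope.

(** Why the theorem holds.

    Write [G z = phi (omega z) - phi 0], so that [h - h 0 = Phi * G] with
    [|Phi| <= 1].  A convex set lies in a half-plane bounded by a line that
    passes arbitrarily close to any given boundary point, so for each [eps > 0]
    some unimodular [u] gives [Re (u G) <= lambda + eps] on the disk, while
    [G 0 = 0].  Caratheodory's inequality ([caratheodory]) applied to
    [lambda + eps - u G] bounds every Taylor coefficient of [G] by [2 lambda]
    ([subordinate_coef_bound]).

    Multiplication by a function bounded by 1 increases neither
    [sum |c_n|^2 r^(2n)] ([rogosinski]) nor, when [r <= 1/3],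
    [sum |c_n| r^n] ([bohr_majorant]).  This transfers the bounds from [G] to
    [h].  It applies again to [g' = q h'], where [|q| < 1] because [f] is
    sense-preserving, and summation by parts ([psum_abel]) removes the factors
    [n] that differentiation introduced: both sums for [g] are at most those
    for [h].  Hence
      [T <= 4 lambda r/(1-r) + (1/(2-lambda) + r/(1-r)) 8 lambda^2 r^2/(1-r^2)],
    and [lambda] minus the right-hand side is
    [lambda * r0_poly lambda r / ((2-lambda) (1-r) (1-r^2))].  The two radii are
    therefore the zeros of [r0_poly lambda] for the given [lambda] and for
    [lambda = 1]; the rest is monotonicity of two cubics.

    The function theory behind these inequalities is set up without contour
    integrals.  A function is called holomorphic if it is strictly
    differentiable at each point of the disk, which is the same as having a
    continuous complex derivative.  The main tool is the mean value
    property ([holomorphic_mean_value]): averages of [F] over the [m]-th roots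
    of unity scaled by [r] tend to [F 0] as [m] grows.  Strict differentiability
    makes a radial increment of [F] proportional to the increment of [F] to the
    next sample point, up to a small relative error, and the latter increments
    sum to zero around the circle.

    Coefficients are handled through expansions
    [F = c_0 + z (c_1 + z (... + z K))] of finite order with holomorphic
    remainders ([taylor]).  They are closed under sums, products, inverses and
    composition by a plain induction on the order, and the mean value property
    expresses [c_n r^n] as a limit of averages of [conj zeta ^ n F (r zeta)].
    Local power series of [phi], [omega] and [Phi] at [0] therefore suffice for
    bounds that hold on the whole disk. *)

(** * Strict complex differentiability *)

(** Both points move, so that an estimate at one centre serves for every pair of
    points nearby; this is what a compactness argument can use. *)
Definition near_pair (z0 : C) (P : C -> C -> Prop) : Prop :=
  exists d : R, 0 < d /\
    forall z w : C, Cmod (z - z0) < d -> Cmod (w - z0) < d -> P z w.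

Lemma near_pair_and (z0 : C) (P Q : C -> C -> Prop) :
  near_pair z0 P -> near_pair z0 Q -> near_pair z0 (fun z w => P z w /\ Q z w).
Proof.
  intros (d & Hd & HP) (e & He & HQ).
  exists (Rmin d e); split; [now apply Rmin_pos|].
  intros z w Hz Hw; split.
  - apply HP; (eapply Rlt_le_trans; [eassumption|apply Rmin_l]).
  - apply HQ; (eapply Rlt_le_trans; [eassumption|apply Rmin_r]).
Qed.

Lemma near_pair_imp (z0 : C) (P Q : C -> C -> Prop) :
  (forall z w, P z w -> Q z w) -> near_pair z0 P -> near_pair z0 Q.
Proof. intros H (d & Hd & HP); exists d; split; auto. Qed.

Definition strict_derivative (F : C -> C) (z0 L : C) : Prop :=
  forall eps : R, 0 < eps ->
    near_pair z0 (fun z w =>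
      Cmod (F w - F z - L * (w - z)) <= eps * Cmod (w - z)).

Definition holomorphic (F : C -> C) : Prop :=
  forall z : C, disk z -> exists L : C, strict_derivative F z L.

Lemma Cmod_self (z : C) : Cmod (z - z) = 0.
Proof. replace (z - z)%C with (RtoC 0) by ring. apply Cmod_0. Qed.

Lemma Cmod_minus_sym (z w : C) : Cmod (z - w) = Cmod (w - z).
Proof. rewrite <- Cmod_opp. f_equal. ring. Qed.

Lemma Cmod_triangle_sub (a b c : C) : Cmod (a - c) <= Cmod (a - b) + Cmod (b - c).
Proof. replace (a - c)%C with ((a - b) + (b - c))%C by ring. apply Cmod_triangle. Qed.

Lemma Cmod_le_add_sub (a b : C) : Cmod a <= Cmod b + Cmod (a - b).
Proof. replace a with (b + (a - b))%C at 1 by ring. apply Cmod_triangle. Qed.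

Lemma strict_derivative_lipschitz (F : C -> C) (z0 L : C) :
  strict_derivative F z0 L ->
  near_pair z0 (fun z w => Cmod (F w - F z) <= (Cmod L + 1) * Cmod (w - z)).
Proof.
  intros H; generalize (H 1 Rlt_0_1); apply near_pair_imp; intros z w Hzw.
  pose proof (Cmod_le_add_sub (F w - F z) (L * (w - z))) as H1.
  rewrite Cmod_mult in H1. lra.
Qed.

Lemma strict_derivative_near_value (F : C -> C) (z0 L : C) (eps : R) :
  strict_derivative F z0 L -> 0 < eps ->
  near_pair z0 (fun z w => Cmod (F z - F z0) < eps /\ Cmod (F w - F z0) < eps).
Proof.
  intros H Heps.
  destruct (strict_derivative_lipschitz _ _ _ H) as (d & Hd & HL).
  pose proof (Cmod_ge_0 L) as HL0.
  assert (He : 0 < eps / (Cmod L + 1)) by (apply Rdiv_lt_0_compat; lra).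
  exists (Rmin d (eps / (Cmod L + 1))); split; [now apply Rmin_pos|].
  assert (Hz0 : Cmod (z0 - z0) < d) by (rewrite Cmod_self; lra).
  assert (Key : forall z, Cmod (z - z0) < Rmin d (eps / (Cmod L + 1)) ->
                 Cmod (F z - F z0) < eps).
  { intros z Hz.
    pose proof (Rmin_l d (eps / (Cmod L + 1))) as Hl.
    pose proof (Rmin_r d (eps / (Cmod L + 1))) as Hr.
    eapply Rle_lt_trans; [apply HL; lra|].
    replace eps with ((Cmod L + 1) * (eps / (Cmod L + 1))) by (field; lra).
    apply Rmult_lt_compat_l; lra. }
  auto.
Qed.

Lemma strict_derivative_ext (F G : C -> C) (z0 L : C) :
  near_pair z0 (fun z w => F z = G z /\ F w = G w) ->
  strict_derivative F z0 L -> strict_derivative G z0 L.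
Proof.
  intros HFG HF eps Heps.
  generalize (near_pair_and _ _ _ HFG (HF eps Heps)); apply near_pair_imp.
  intros z w [[<- <-] H]; exact H.
Qed.

Lemma strict_derivative_const (c z0 : C) : strict_derivative (fun _ => c) z0 0.
Proof.
  intros eps Heps; exists 1; split; [lra|]; intros z w _ _.
  replace (c - c - 0 * (w - z))%C with (RtoC 0) by ring. rewrite Cmod_0.
  apply Rmult_le_pos; [lra|apply Cmod_ge_0].
Qed.

Lemma strict_derivative_id (z0 : C) : strict_derivative (fun z => z) z0 1.
Proof.
  intros eps Heps; exists 1; split; [lra|]; intros z w _ _.
  replace (w - z - 1 * (w - z))%C with (RtoC 0) by ring. rewrite Cmod_0.
  apply Rmult_le_pos; [lra|apply Cmod_ge_0].
Qed.

Lemma strict_derivative_plus (F G : C -> C) (z0 L M : C) :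
  strict_derivative F z0 L -> strict_derivative G z0 M ->
  strict_derivative (fun z => F z + G z)%C z0 (L + M).
Proof.
  intros HF HG eps Heps.
  assert (H2 : 0 < eps / 2) by lra.
  generalize (near_pair_and _ _ _ (HF _ H2) (HG _ H2)); apply near_pair_imp.
  intros z w [H H'].
  replace (F w + G w - (F z + G z) - (L + M) * (w - z))%C
    with ((F w - F z - L * (w - z)) + (G w - G z - M * (w - z)))%C by ring.
  eapply Rle_trans; [apply Cmod_triangle|]. lra.
Qed.

(** With [z, w] close to [z0], the factors [G w] and [F z] may be frozen at
    [z0]; the constant [B] collects the coefficients of the four error terms. *)
Lemma strict_derivative_mult (F G : C -> C) (z0 L M : C) :
  strict_derivative F z0 L -> strict_derivative G z0 M ->
  strict_derivative (fun z => F z * G z)%C z0 (L * G z0 + F z0 * M).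
Proof.
  intros HF HG eps Heps.
  set (B := Cmod (G z0) + 1 + Cmod L + (Cmod (F z0) + 1) + Cmod M).
  pose proof (Cmod_ge_0 (G z0)) as B1. pose proof (Cmod_ge_0 L) as B2.
  pose proof (Cmod_ge_0 (F z0)) as B3. pose proof (Cmod_ge_0 M) as B4.
  assert (HB : 0 < B) by (unfold B; lra).
  set (eta := Rmin 1 (eps / B)).
  assert (Heta : 0 < eta) by (apply Rmin_pos; [lra|now apply Rdiv_lt_0_compat]).
  assert (Heta1 : eta <= 1) by apply Rmin_l.
  assert (HetaB : eta * B <= eps).
  { replace eps with (eps / B * B) by (field; lra).
    apply Rmult_le_compat_r; [lra|apply Rmin_r]. }
  generalize (near_pair_and _ _ _
    (near_pair_and _ _ _ (HF _ Heta) (HG _ Heta))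
    (near_pair_and _ _ _ (strict_derivative_near_value _ _ _ _ HF Heta)
       (strict_derivative_near_value _ _ _ _ HG Heta))).
  apply near_pair_imp; intros z w [[H1 H2] [[H3 _] [_ H4]]].
  replace (F w * G w - F z * G z - (L * G z0 + F z0 * M) * (w - z))%C
    with ((F w - F z - L * (w - z)) * G w + L * (G w - G z0) * (w - z)
          + (F z * (G w - G z - M * (w - z)) + M * (F z - F z0) * (w - z)))%C by ring.
  eapply Rle_trans; [apply Cmod_triangle|].
  eapply Rle_trans; [apply Rplus_le_compat; apply Cmod_triangle|].
  rewrite !Cmod_mult.
  pose proof (Cmod_le_add_sub (G w) (G z0)) as H5.
  pose proof (Cmod_le_add_sub (F z) (F z0)) as H6.
  set (D := Cmod (w - z)) in *. assert (HD : 0 <= D) by apply Cmod_ge_0.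
  assert (T1 : Cmod (F w - F z - L * (w - z)) * Cmod (G w) <= eta * D * (Cmod (G z0) + 1)).
  { apply Rmult_le_compat; try apply Cmod_ge_0; lra. }
  assert (T2 : Cmod L * Cmod (G w - G z0) * D <= Cmod L * eta * D).
  { apply Rmult_le_compat_r; [lra|]; apply Rmult_le_compat_l; lra. }
  assert (T3 : Cmod (F z) * Cmod (G w - G z - M * (w - z)) <= (Cmod (F z0) + 1) * (eta * D)).
  { apply Rmult_le_compat; try apply Cmod_ge_0; lra. }
  assert (T4 : Cmod M * Cmod (F z - F z0) * D <= Cmod M * eta * D).
  { apply Rmult_le_compat_r; [lra|]; apply Rmult_le_compat_l; lra. }
  apply Rle_trans with (eta * B * D).
  - unfold B. lra.
  - apply Rmult_le_compat_r; lra.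
Qed.

Lemma strict_derivative_comp (F W : C -> C) (z0 L M : C) :
  strict_derivative W z0 M -> strict_derivative F (W z0) L ->
  strict_derivative (fun z => F (W z)) z0 (L * M).
Proof.
  intros HW HF eps Heps.
  pose proof (Cmod_ge_0 L) as B1. pose proof (Cmod_ge_0 M) as B2.
  set (B := Cmod L + Cmod M + 1).
  assert (HB : 0 < B) by (unfold B; lra).
  assert (Heta : 0 < eps / B) by now apply Rdiv_lt_0_compat.
  destruct (HF _ Heta) as (d & Hd & HFd).
  generalize (near_pair_and _ _ _ (strict_derivative_lipschitz _ _ _ HW)
    (near_pair_and _ _ _ (HW _ Heta) (strict_derivative_near_value _ _ _ _ HW Hd))).
  apply near_pair_imp; intros z w (H1 & H2 & H3 & H4).
  specialize (HFd _ _ H3 H4).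
  replace (F (W w) - F (W z) - L * M * (w - z))%C
    with ((F (W w) - F (W z) - L * (W w - W z)) + L * (W w - W z - M * (w - z)))%C by ring.
  eapply Rle_trans; [apply Cmod_triangle|]. rewrite Cmod_mult.
  set (D := Cmod (w - z)) in *. assert (HD : 0 <= D) by apply Cmod_ge_0.
  assert (T1 : Cmod (F (W w) - F (W z) - L * (W w - W z)) <= eps / B * ((Cmod M + 1) * D)).
  { eapply Rle_trans; [exact HFd|]. apply Rmult_le_compat_l; lra. }
  assert (T2 : Cmod L * Cmod (W w - W z - M * (w - z)) <= Cmod L * (eps / B * D)).
  { apply Rmult_le_compat_l; lra. }
  replace (eps * D) with (eps / B * ((Cmod M + 1) * D) + Cmod L * (eps / B * D))
    by (unfold B; field; lra).
  lra.
Qed.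

Lemma strict_derivative_inv (z0 : C) :
  z0 <> 0 -> strict_derivative (fun z => / z)%C z0 (- (/ z0 * / z0)).
Proof.
  intros Hz0 eps Heps.
  apply Cmod_gt_0 in Hz0 as Hm.
  set (m := Cmod z0) in *.
  (* |1/z0^2 - 1/(zw)| <= (|z||w-z0| + |z0||z-z0|)/(|z0|^2|z||w|), and |z|, |w| >= m/2 *)
  set (d := Rmin (m / 2) (eps * m ^ 3 / 10)).
  assert (Hm3 : 0 < m ^ 3) by now apply pow_lt.
  assert (Hd : 0 < d).
  { apply Rmin_pos; [lra|]. apply Rdiv_lt_0_compat; [|lra]. now apply Rmult_lt_0_compat. }
  exists d; split; [exact Hd|]. intros z w Hz Hw.
  assert (Hd1 : d <= m / 2) by apply Rmin_l.
  assert (Hd2 : d <= eps * m ^ 3 / 10) by apply Rmin_r.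
  assert (Lz : m / 2 <= Cmod z).
  { pose proof (Cmod_le_add_sub z0 z) as H. rewrite (Cmod_minus_sym z0 z) in H.
    fold m in H. lra. }
  assert (Lw : m / 2 <= Cmod w).
  { pose proof (Cmod_le_add_sub z0 w) as H. rewrite (Cmod_minus_sym z0 w) in H.
    fold m in H. lra. }
  assert (Uz : Cmod z <= 3 / 2 * m).
  { pose proof (Cmod_le_add_sub z z0) as H. fold m in H. lra. }
  assert (Nz : z <> 0) by (apply Cmod_gt_0; lra).
  assert (Nw : w <> 0) by (apply Cmod_gt_0; lra).
  replace (/ w - / z - - (/ z0 * / z0) * (w - z))%C
    with ((z * (w - z0) + z0 * (z - z0)) / (z0 * z0 * z * w) * (w - z))%C
    by (field; auto).
  rewrite Cmod_mult, Cmod_div, !Cmod_mult by (repeat apply Cmult_neq_0; auto).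
  apply Rmult_le_compat_r; [apply Cmod_ge_0|]. fold m.
  assert (Num : Cmod (z * (w - z0) + z0 * (z - z0)) <= 5 / 2 * m * d).
  { eapply Rle_trans; [apply Cmod_triangle|]. rewrite !Cmod_mult. fold m.
    assert (Cmod z * Cmod (w - z0) <= 3 / 2 * m * d)
      by (apply Rmult_le_compat; try apply Cmod_ge_0; lra).
    assert (m * Cmod (z - z0) <= m * d) by (apply Rmult_le_compat_l; lra).
    lra. }
  assert (Den : m * m * (m / 2) * (m / 2) <= m * m * Cmod z * Cmod w).
  { assert (0 < m * m) by now apply Rmult_lt_0_compat.
    apply Rmult_le_compat; [apply Rmult_le_pos; lra|lra| |lra].
    apply Rmult_le_compat_l; lra. }
  assert (Dp : 0 < m * m * (m / 2) * (m / 2)) by (repeat apply Rmult_lt_0_compat; lra).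
  apply Rle_div_l; [lra|].
  apply Rle_trans with (eps * (m * m * (m / 2) * (m / 2))).
  - eapply Rle_trans; [exact Num|].
    apply Rle_trans with (5 / 2 * m * (eps * m ^ 3 / 10)).
    + apply Rmult_le_compat_l; lra.
    + right; field.
  - apply Rmult_le_compat_l; lra.
Qed.

Lemma disk_near (z0 : C) : disk z0 -> near_pair z0 (fun z w => disk z /\ disk w).
Proof.
  unfold disk; intros H; exists (1 - Cmod z0); split; [lra|].
  intros z w Hz Hw.
  pose proof (Cmod_le_add_sub z z0). pose proof (Cmod_le_add_sub w z0). lra.
Qed.

Lemma holomorphic_ext (F G : C -> C) :
  (forall z, disk z -> F z = G z) -> holomorphic F -> holomorphic G.
Proof.
  intros HFG HF z Hz. destruct (HF z Hz) as [L HL]; exists L.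
  apply strict_derivative_ext with F; [|exact HL].
  generalize (disk_near z Hz); apply near_pair_imp; intros u v []; auto.
Qed.

Lemma holomorphic_const (c : C) : holomorphic (fun _ => c).
Proof. intros z _; eexists; apply strict_derivative_const. Qed.

Lemma holomorphic_id : holomorphic (fun z => z).
Proof. intros z _; eexists; apply strict_derivative_id. Qed.

Lemma holomorphic_plus (F G : C -> C) :
  holomorphic F -> holomorphic G -> holomorphic (fun z => F z + G z)%C.
Proof.
  intros HF HG z Hz. destruct (HF z Hz), (HG z Hz).
  eexists; apply strict_derivative_plus; eassumption.
Qed.

Lemma holomorphic_mult (F G : C -> C) :
  holomorphic F -> holomorphic G -> holomorphic (fun z => F z * G z)%C.
Proof.
  intros HF HG z Hz. destruct (HF z Hz), (HG z Hz).
  eexists; apply strict_derivative_mult; eassumption.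
Qed.

Lemma holomorphic_comp (F W : C -> C) :
  holomorphic F -> holomorphic W -> (forall z, disk z -> disk (W z)) ->
  holomorphic (fun z => F (W z)).
Proof.
  intros HF HW HD z Hz. destruct (HF (W z) (HD z Hz)), (HW z Hz).
  eexists; eapply strict_derivative_comp; eassumption.
Qed.

Lemma holomorphic_inv (F : C -> C) :
  holomorphic F -> (forall z, disk z -> F z <> 0) -> holomorphic (fun z => / F z)%C.
Proof.
  intros HF H0 z Hz. destruct (HF z Hz).
  eexists; eapply (strict_derivative_comp (fun z => / z)%C F);
    [eassumption|apply strict_derivative_inv; auto].
Qed.

Lemma holomorphic_pow (F : C -> C) (n : nat) :
  holomorphic F -> holomorphic (fun z => F z ^ n)%C.
Proof.
  intros HF; induction n as [|n IH].
  - exact (holomorphic_const 1).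
  - apply (holomorphic_mult F (fun z => F z ^ n)%C HF IH).
Qed.


(** * Means over roots of unity *)

Lemma Cmod_le_coords (z : C) : Cmod z <= Rabs (Re z) + Rabs (Im z).
Proof.
  destruct z as [x y].
  replace (x, y) with (RtoC x + RtoC y * Ci)%C
    by (unfold Cplus, Cmult, RtoC, Ci; simpl; f_equal; ring).
  eapply Rle_trans; [apply Cmod_triangle|].
  rewrite Cmod_mult, Cmod_Ci, !Cmod_R. simpl.
  right. f_equal; [f_equal; ring|rewrite Rmult_1_r; f_equal; ring].
Qed.

Lemma im_le_Cmod (c : C) : Rabs (Im c) <= Cmod c.
Proof. eapply Rle_trans; [apply Rmax_r|apply (Rmax_Cmod c)]. Qed.

(** Compactness of the closed disk of radius [r] makes the scale [d] uniform.  The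
    slope [L] still depends on the centre. *)
Lemma holomorphic_uniform (F : C -> C) (r eps : R) :
  holomorphic F -> 0 < r < 1 -> 0 < eps ->
  exists d : R, 0 < d /\ forall z : C, Cmod z <= r -> exists L : C,
    forall w w' : C, Cmod (w - z) < d -> Cmod (w' - z) < d ->
      Cmod (F w' - F w - L * (w' - w)) <= eps * Cmod (w' - w).
Proof.
  intros HF Hr Heps.
  set (Q := fun (u v : R) (d : posreal) => forall z : C, Cmod z <= r ->
    Rabs (Re z - u) < d -> Rabs (Im z - v) < d -> exists L : C,
    forall w w' : C, Cmod (w - z) < d -> Cmod (w' - z) < d ->
      Cmod (F w' - F w - L * (w' - w)) <= eps * Cmod (w' - w)).
  assert (HQ : forall u v, exists d : posreal, Q u v d).
  { intros u v. set (t := (u, v) : C).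
    assert (Hdist : forall z, Cmod (z - t) <= Rabs (Re z - u) + Rabs (Im z - v))
      by (intros z; apply Cmod_le_coords).
    destruct (Rlt_le_dec (Cmod t) 1) as [Ht|Ht].
    - destruct (HF t Ht) as [L HL]. destruct (HL eps Heps) as (d & Hd & Hdd).
      assert (Hd3 : 0 < d / 3) by lra.
      exists (mkposreal _ Hd3). intros z Hz Hx Hy; simpl in *. exists L.
      specialize (Hdist z).
      intros w w' Hw Hw'; apply Hdd.
      + pose proof (Cmod_triangle_sub w z t). lra.
      + pose proof (Cmod_triangle_sub w' z t). lra.
    (* centres outside the disk are at distance at least [1 - r] from the points [z] *)
    - assert (Hd : 0 < (1 - r) / 2) by lra.
      exists (mkposreal _ Hd). intros z Hz Hx Hy; simpl in *. exfalso.
      specialize (Hdist z). pose proof (Cmod_le_add_sub t z).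
      rewrite (Cmod_minus_sym t z) in *. lra. }
  set (delta := fun u v => proj1_sig (constructive_indefinite_description _ (HQ u v))).
  assert (Hdelta : forall u v, Q u v (delta u v))
    by (intros u v; apply proj2_sig).
  destruct (compactness_value_2d (-1) 1 (-1) 1 delta) as [d Hd].
  exists d; split; [apply cond_pos|]. intros z Hz.
  pose proof (re_le_Cmod z) as H1. pose proof (im_le_Cmod z) as H2.
  apply Rabs_le_between in H1, H2.
  assert (Hx : -1 <= Re z <= 1) by lra. assert (Hy : -1 <= Im z <= 1) by lra.
  destruct (NNPP _ (Hd _ _ Hx Hy)) as (u & v & _ & _ & Hu & Hv & Hle).
  destruct (Hdelta u v z Hz Hu Hv) as [L HL]. exists L.
  intros w w' Hw Hw'; apply HL; lra.
Qed.

Fixpoint csum (u : nat -> C) (n : nat) : C :=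
  match n with O => 0 | S k => (csum u k + u k)%C end.

Lemma csum_ext (u v : nat -> C) (n : nat) :
  (forall k, u k = v k) -> csum u n = csum v n.
Proof. intros H; induction n as [|n IH]; simpl; [|rewrite IH, H]; reflexivity. Qed.

Lemma csum_lin (c : C) (u v : nat -> C) (n : nat) :
  csum (fun k => u k + c * v k)%C n = (csum u n + c * csum v n)%C.
Proof. induction n as [|n IH]; simpl; [|rewrite IH]; ring. Qed.

Lemma csum_conj (u : nat -> C) (n : nat) :
  csum (fun k => Cconj (u k)) n = Cconj (csum u n).
Proof.
  induction n as [|n IH]; simpl.
  - unfold Cconj, RtoC; simpl; f_equal; ring.
  - rewrite IH, Cplus_conj; reflexivity.
Qed.

Lemma csum_const (c : C) (n : nat) : csum (fun _ => c) n = (RtoC (INR n) * c)%C.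
Proof.
  induction n as [|n IH]; [simpl; ring|].
  rewrite S_INR, RtoC_plus; simpl csum; rewrite IH; ring.
Qed.

Lemma csum_telescope (u : nat -> C) (n : nat) :
  csum (fun k => u (S k) - u k)%C n = (u n - u O)%C.
Proof. induction n as [|n IH]; simpl; [|rewrite IH]; ring. Qed.

Lemma csum_S_l (u : nat -> C) (n : nat) :
  csum u (S n) = (u O + csum (fun k => u (S k)) n)%C.
Proof.
  induction n as [|n IH]; [simpl; ring|].
  change (csum u (S (S n))) with (csum u (S n) + u (S n))%C. rewrite IH. simpl; ring.
Qed.

Lemma csum_Cmod_le (u : nat -> C) (B : R) (n : nat) :
  (forall k, Cmod (u k) <= B) -> Cmod (csum u n) <= INR n * B.
Proof.
  intros H; induction n as [|n IH].
  - simpl. rewrite Cmod_0; lra.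
  - rewrite S_INR; simpl csum. eapply Rle_trans; [apply Cmod_triangle|].
    specialize (H n); lra.
Qed.

Lemma csum_re_le (u v : nat -> C) (n : nat) :
  (forall k, Re (u k) <= Re (v k)) -> Re (csum u n) <= Re (csum v n).
Proof.
  intros H; induction n as [|n IH]; simpl; [lra|].
  specialize (H n). unfold Re in *; simpl; lra.
Qed.

Definition cis (t : R) : C := (cos t, sin t).

Lemma Cmod_cis (t : R) : Cmod (cis t) = 1.
Proof.
  unfold Cmod, cis; simpl fst; simpl snd.
  replace (cos t ^ 2 + sin t ^ 2) with 1.
  - apply sqrt_1.
  - pose proof (sin2_cos2 t) as H. unfold Rsqr in H. lra.
Qed.

Lemma cis_pow (t : R) (n : nat) : (cis t ^ n)%C = cis (INR n * t).
Proof.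
  induction n as [|n IH].
  - simpl. rewrite Rmult_0_l. unfold cis. now rewrite cos_0, sin_0.
  - rewrite Cpow_S, IH, S_INR.
    replace ((INR n + 1) * t) with (t + INR n * t) by ring.
    unfold cis, Cmult; simpl. now rewrite cos_plus, sin_plus, (Rplus_comm (_ * _)).
Qed.

(** The chord [2 sin (t/2)] is shorter than the arc [t]. *)
Lemma Cmod_cis_sub_1 (t : R) : 0 < t <= 2 * PI -> Cmod (cis t - 1) <= t.
Proof.
  intros Ht. unfold Cmod, cis, Cminus, Cplus, Copp, RtoC; simpl fst; simpl snd.
  rewrite <- (sqrt_pow2 t) at 3 by lra. apply sqrt_le_1_alt.
  assert (Hc : cos t = 1 - 2 * sin (t / 2) * sin (t / 2)).
  { rewrite <- cos_2a_sin. f_equal. field. }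
  pose proof (sin2_cos2 t) as H1. unfold Rsqr in H1.
  assert (Hs : (sin (t / 2)) ^ 2 <= (t / 2) ^ 2).
  { apply pow_incr; split; [apply sin_ge_0; lra|apply Rlt_le, sin_lt_x; lra]. }
  nra.
Qed.

(** Index [m] stands for the [m+1]-st roots of unity, so that an average is never
    over an empty sample. *)
Definition root (m : nat) : C := cis (2 * PI / INR (S m)).

Lemma Cmod_root_pow (m k : nat) : Cmod (root m ^ k) = 1.
Proof. unfold root. rewrite cis_pow. apply Cmod_cis. Qed.

Lemma root_pow_period (m : nat) : (root m ^ S m)%C = 1.
Proof.
  unfold root. rewrite cis_pow.
  replace (INR (S m) * (2 * PI / INR (S m))) with (2 * PI)
    by (field; apply not_0_INR; lia).
  unfold cis. now rewrite cos_2PI, sin_2PI.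
Qed.

Lemma root_neq_1 (m : nat) : (1 <= m)%nat -> (root m - 1)%C <> 0.
Proof.
  intros Hm H. apply (f_equal Re) in H.
  unfold root, cis, Re, Cminus, Cplus, Copp, RtoC in H; cbn [fst] in H.
  pose proof PI_RGT_0 as HPI.
  assert (H2 : 2 <= INR (S m)) by (apply (le_INR 2); lia).
  set (t := 2 * PI / INR (S m)) in *.
  assert (Ht : 0 < t) by (apply Rdiv_lt_0_compat; lra).
  assert (Ht' : t <= PI).
  { apply Rle_div_l; [lra|]. rewrite (Rmult_comm 2). apply Rmult_le_compat_l; lra. }
  pose proof (cos_decreasing_1 0 t) as Hc. rewrite cos_0 in Hc. lra.
Qed.

Lemma root_near_1 (d : R) : 0 < d ->
  exists M : nat, forall m, (M <= m)%nat -> Cmod (root m - 1) < d.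
Proof.
  intros Hd. pose proof PI_RGT_0 as HPI.
  destruct (INR_unbounded (2 * PI / d)) as [M HM]. exists M; intros m Hm.
  apply le_INR in Hm. pose proof (pos_INR m) as Hp.
  assert (HS : 0 < INR (S m)) by (rewrite S_INR; lra).
  eapply Rle_lt_trans; [apply Cmod_cis_sub_1; split|].
  - apply Rdiv_lt_0_compat; lra.
  - apply Rle_div_l; [lra|]. rewrite S_INR.
    rewrite <- (Rmult_1_r (2 * PI)) at 1. apply Rmult_le_compat_l; lra.
  - apply Rlt_div_l; [lra|]. apply Rlt_div_l in HM; [|lra].
    rewrite S_INR. nra.
Qed.

Definition mean (m : nat) (v : C -> C) : C :=
  (csum (fun k => v (root m ^ k)) (S m) / RtoC (INR (S m)))%C.

Lemma INR_S_neq_0 (m : nat) : RtoC (INR (S m)) <> 0.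
Proof. intros H. apply RtoC_inj in H. now apply (not_0_INR (S m)) in H. Qed.

Lemma Cmod_mean_diff_le (m : nat) (v v' : C -> C) (B : R) :
  (forall zeta, Cmod zeta = 1 -> Cmod (v zeta - v' zeta) <= B) ->
  Cmod (mean m v - mean m v') <= B.
Proof.
  intros H. unfold mean. pose proof (INR_S_neq_0 m) as HN.
  replace (csum (fun k => v (root m ^ k)) (S m) / INR (S m)
           - csum (fun k => v' (root m ^ k)) (S m) / INR (S m))%C
    with (csum (fun k => v (root m ^ k) + (-(1)) * v' (root m ^ k)) (S m) / INR (S m))%C
    by (rewrite csum_lin; field; auto).
  rewrite Cmod_div, Cmod_R, Rabs_right by (auto; apply Rle_ge, pos_INR).
  assert (HS : 0 < INR (S m)) by (apply (lt_INR 0); lia).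
  apply Rle_div_l; [lra|]. rewrite Rmult_comm. apply csum_Cmod_le.
  intros k. replace (v (root m ^ k) + - (1) * v' (root m ^ k))%C
    with (v (root m ^ k) - v' (root m ^ k))%C by ring.
  apply H, Cmod_root_pow.
Qed.

Lemma mean_const (m : nat) (c : C) : mean m (fun _ => c) = c.
Proof. unfold mean. rewrite csum_const. field. apply INR_S_neq_0. Qed.

Definition mean_lim (v : C -> C) (l : C) : Prop :=
  forall eps : R, 0 < eps ->
    exists M : nat, forall m : nat, (M <= m)%nat -> Cmod (mean m v - l) < eps.

Lemma mean_lim_unique (v : C -> C) (l l' : C) :
  mean_lim v l -> mean_lim v l' -> l = l'.
Proof.
  intros H H'. apply Ceq_minus, Cmod_eq_0.
  destruct (Rle_lt_or_eq_dec _ _ (Cmod_ge_0 (l - l'))) as [Hp|He]; [|auto].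
  exfalso. assert (Hp2 : 0 < Cmod (l - l') / 2) by lra.
  destruct (H _ Hp2) as [M HM]. destruct (H' _ Hp2) as [M' HM'].
  specialize (HM (M + M')%nat ltac:(lia)). specialize (HM' (M + M')%nat ltac:(lia)).
  pose proof (Cmod_triangle_sub l (mean (M + M') v) l').
  rewrite (Cmod_minus_sym l (mean _ v)) in *. lra.
Qed.

Lemma mean_lim_ext (v v' : C -> C) (l : C) :
  (forall zeta, Cmod zeta = 1 -> v zeta = v' zeta) ->
  mean_lim v l -> mean_lim v' l.
Proof.
  intros Hv H eps Heps. destruct (H eps Heps) as [M HM]. exists M; intros m Hm.
  replace (mean m v') with (mean m v); [auto|].
  unfold mean. f_equal. apply csum_ext; intros k. apply Hv, Cmod_root_pow.
Qed.

Lemma mean_lim_const (c : C) : mean_lim (fun _ => c) c.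
Proof.
  intros eps Heps; exists O; intros m _. rewrite mean_const, Cmod_self. exact Heps.
Qed.

Lemma mean_lim_lin (c : C) (v v' : C -> C) (l l' : C) :
  mean_lim v l -> mean_lim v' l' ->
  mean_lim (fun zeta => v zeta + c * v' zeta)%C (l + c * l').
Proof.
  intros H H' eps Heps.
  pose proof (Cmod_ge_0 c) as Hc.
  assert (He : 0 < eps / (Cmod c + 1)) by (apply Rdiv_lt_0_compat; lra).
  destruct (H _ He) as [M HM]. destruct (H' _ He) as [M' HM'].
  exists (M + M')%nat; intros m Hm.
  specialize (HM m ltac:(lia)). specialize (HM' m ltac:(lia)).
  replace (mean m (fun zeta => v zeta + c * v' zeta)%C) with (mean m v + c * mean m v')%C.
  - replace (mean m v + c * mean m v' - (l + c * l'))%C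
      with ((mean m v - l) + c * (mean m v' - l'))%C by ring.
    eapply Rle_lt_trans; [apply Cmod_triangle|]. rewrite Cmod_mult.
    replace eps with (eps / (Cmod c + 1) + Cmod c * (eps / (Cmod c + 1))) by (field; lra).
    apply Rplus_lt_le_compat; [lra|]. apply Rmult_le_compat_l; lra.
  - unfold mean. rewrite csum_lin. field. apply INR_S_neq_0.
Qed.

Lemma mean_lim_plus (v v' : C -> C) (l l' : C) :
  mean_lim v l -> mean_lim v' l' ->
  mean_lim (fun zeta => v zeta + v' zeta)%C (l + l').
Proof.
  intros H H'. replace (l + l')%C with (l + 1 * l')%C by ring.
  apply mean_lim_ext with (fun zeta => v zeta + 1 * v' zeta)%C;
    [intros; ring|now apply mean_lim_lin].
Qed.

Lemma mean_lim_scal (c : C) (v : C -> C) (l : C) :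
  mean_lim v l -> mean_lim (fun zeta => c * v zeta)%C (c * l).
Proof.
  intros H. replace (c * l)%C with (0 + c * l)%C by ring.
  apply mean_lim_ext with (fun zeta => 0 + c * v zeta)%C;
    [intros; ring|apply mean_lim_lin; [apply mean_lim_const|exact H]].
Qed.

Lemma mean_lim_conj (v : C -> C) (l : C) :
  mean_lim v l -> mean_lim (fun zeta => Cconj (v zeta)) (Cconj l).
Proof.
  intros H eps Heps. destruct (H eps Heps) as [M HM]. exists M; intros m Hm.
  replace (mean m (fun zeta => Cconj (v zeta))) with (Cconj (mean m v)).
  - rewrite <- Cminus_conj, Cmod_conj; auto.
  - unfold mean. rewrite csum_conj, Cdiv_conj by apply INR_S_neq_0.
    f_equal. unfold Cconj, RtoC; simpl; f_equal; ring.
Qed.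

Lemma mean_lim_re_le (v v' : C -> C) (l l' : C) :
  (forall zeta, Cmod zeta = 1 -> Re (v zeta) <= Re (v' zeta)) ->
  mean_lim v l -> mean_lim v' l' -> Re l <= Re l'.
Proof.
  intros Hv H H'. apply Rnot_lt_le; intros Hlt.
  assert (Hp : 0 < (Re l - Re l') / 2) by lra.
  destruct (H _ Hp) as [M HM]. destruct (H' _ Hp) as [M' HM'].
  specialize (HM (M + M')%nat ltac:(lia)). specialize (HM' (M + M')%nat ltac:(lia)).
  set (m := (M + M')%nat) in *.
  assert (Hle : Re (mean m v) <= Re (mean m v')).
  { unfold mean, Cdiv. rewrite <- RtoC_inv by (apply not_0_INR; lia).
    rewrite !re_scal_r. apply Rmult_le_compat_r.
    - apply Rlt_le, Rinv_0_lt_compat, (lt_INR 0); lia.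
    - apply csum_re_le; intros k; apply Hv, Cmod_root_pow. }
  pose proof (re_le_Cmod (mean m v - l)) as H1.
  pose proof (re_le_Cmod (mean m v' - l')) as H2.
  apply Rabs_le_between in H1, H2.
  unfold Re in *; simpl in *. lra.
Qed.

(** A path from [s] to [r] is cut into steps shorter than [d]. *)
Lemma local_lipschitz_global (A : R -> C) (s r K d : R) :
  0 < s <= r -> 0 < d -> 0 <= K ->
  (forall t t', 0 < t <= r -> 0 < t' <= r -> Rabs (t' - t) < d ->
     Cmod (A t' - A t) <= K * Rabs (t' - t)) ->
  Cmod (A r - A s) <= K * (r - s).
Proof.
  intros Hs Hd HK HA.
  destruct (INR_unbounded ((r - s) / d)) as [n Hn].
  apply Rlt_div_l in Hn; [|lra].
  assert (HS : 0 < INR (S n)) by (apply (lt_INR 0); lia).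
  set (h := (r - s) / INR (S n)).
  assert (Hh0 : 0 <= h) by (apply Rdiv_le_0_compat; lra).
  assert (Hhd : h < d).
  { apply Rlt_div_l; [lra|]. rewrite S_INR. lra. }
  assert (Hr : INR (S n) * h = r - s) by (unfold h; field; lra).
  assert (Hj : forall j, (j <= S n)%nat ->
             Cmod (A (s + INR j * h) - A s) <= K * (INR j * h)).
  { induction j as [|j IH]; intros Hj.
    - simpl INR. rewrite Rmult_0_l, Rplus_0_r, Cmod_self. lra.
    - specialize (IH ltac:(lia)).
      eapply Rle_trans; [apply (Cmod_triangle_sub _ (A (s + INR j * h)))|].
      assert (Hjr : INR (S j) * h <= r - s).
      { rewrite <- Hr. apply Rmult_le_compat_r; [lra|]. now apply le_INR. }
      pose proof (Rmult_le_pos _ _ (pos_INR j) Hh0) as Hj0.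
      rewrite S_INR in *.
      assert (Hstep : s + (INR j + 1) * h - (s + INR j * h) = h) by ring.
      pose proof (HA (s + INR j * h) (s + (INR j + 1) * h)) as H.
      rewrite Hstep, (Rabs_right h) in H by lra.
      specialize (H ltac:(lra) ltac:(lra) Hhd). lra. }
  specialize (Hj (S n) (le_n _)). rewrite Hr in Hj.
  now replace (s + (r - s)) with r in Hj by ring.
Qed.

(** Near the sample point [x = s zeta^k], [F] is affine with some slope [L] up to
    a relative error [eps].  Its radial increment [L (s' - s) zeta^k] is thus [q]
    times its increment [L s zeta^k (zeta - 1)] to the next sample point, with
    [q] independent of [k] and of [L].  The second kind of increments telescopes
    to zero around the circle. *)
Lemma mean_radial_step (F : C -> C) (m : nat) (s s' d eps : R) :
  (1 <= m)%nat -> 0 < s ->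
  (forall z : C, Cmod z <= s -> exists L : C,
    forall w w' : C, Cmod (w - z) < d -> Cmod (w' - z) < d ->
      Cmod (F w' - F w - L * (w' - w)) <= eps * Cmod (w' - w)) ->
  Rabs (s' - s) < d -> s * Cmod (root m - 1) < d ->
  Cmod (mean m (fun zeta => F (s' * zeta)%C) - mean m (fun zeta => F (s * zeta)%C))
    <= 2 * eps * Rabs (s' - s).
Proof.
  intros Hm Hs HF Hss Hroot.
  pose proof (root_neq_1 m Hm) as Hne.
  assert (HsC : RtoC s <> 0) by (intros H; apply RtoC_inj in H; lra).
  set (q := ((s' - s) / (s * (root m - 1)))%C).
  set (D := fun k => (F (s' * root m ^ k) + (-(1)) * F (s * root m ^ k)
              + (-q) * (F (s * root m ^ S k) - F (s * root m ^ k)))%C).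
  assert (HD : forall k, Cmod (D k) <= 2 * eps * Rabs (s' - s)).
  { intros k. set (x := (root m ^ k)%C).
    assert (Hx : Cmod x = 1) by apply Cmod_root_pow.
    destruct (HF (s * x)%C) as [L HL].
    { rewrite Cmod_mult, Cmod_R, Hx, Rabs_right by lra. lra. }
    assert (E1 : Cmod (s' * x - s * x) = Rabs (s' - s)).
    { replace (s' * x - s * x)%C with ((s' - s) * x)%C by ring.
      rewrite <- RtoC_minus, Cmod_mult, Cmod_R, Hx. ring. }
    assert (E2 : Cmod (s * (root m * x) - s * x) = s * Cmod (root m - 1)).
    { replace (s * (root m * x) - s * x)%C with (s * (root m - 1) * x)%C by ring.
      rewrite !Cmod_mult, Cmod_R, Hx, Rabs_right by lra. ring. }
    assert (E3 : Cmod (s * x - s * x) < d).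
    { rewrite Cmod_self. pose proof (Rabs_pos (s' - s)). lra. }
    pose proof (HL _ (s' * x)%C E3 ltac:(lra)) as H1.
    pose proof (HL _ (s * (root m * x))%C E3 ltac:(lra)) as H2.
    rewrite E1 in H1. rewrite E2 in H2.
    unfold D. rewrite Cpow_S. fold x.
    replace (F (s' * x) + - (1) * F (s * x) + - q * (F (s * (root m * x)) - F (s * x)))%C
      with ((F (s' * x) - F (s * x) - L * (s' * x - s * x))
            + - q * (F (s * (root m * x)) - F (s * x) - L * (s * (root m * x) - s * x)))%C
      by (unfold q; field; auto).
    eapply Rle_trans; [apply Cmod_triangle|]. rewrite Cmod_mult, Cmod_opp.
    assert (Hq : Cmod q * (s * Cmod (root m - 1)) = Rabs (s' - s)).
    { unfold q. rewrite <- RtoC_minus, Cmod_div, Cmod_mult, !Cmod_R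
        by (now apply Cmult_neq_0).
      rewrite (Rabs_right s) by lra. apply Cmod_gt_0 in Hne. field. split; lra. }
    apply Rle_trans with (eps * Rabs (s' - s) + Cmod q * (eps * (s * Cmod (root m - 1)))).
    - apply Rplus_le_compat; [lra|]. apply Rmult_le_compat_l; [apply Cmod_ge_0|lra].
    - rewrite <- Hq. right; ring. }
  assert (Hsum : csum D (S m) =
    (csum (fun k => F (s' * root m ^ k)) (S m) - csum (fun k => F (s * root m ^ k)) (S m))%C).
  { unfold D. rewrite csum_lin, csum_lin, (csum_telescope (fun k => F (s * root m ^ k)%C)).
    rewrite root_pow_period. simpl Cpow. ring. }
  unfold mean.
  replace (csum (fun k => F (s' * root m ^ k)) (S m) / INR (S m)
           - csum (fun k => F (s * root m ^ k)) (S m) / INR (S m))%C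
    with (csum D (S m) / INR (S m))%C
    by (rewrite Hsum; field; apply INR_S_neq_0).
  rewrite Cmod_div, Cmod_R, Rabs_right
    by (try apply INR_S_neq_0; apply Rle_ge, pos_INR).
  apply Rle_div_l; [apply (lt_INR 0); lia|].
  rewrite Rmult_comm. now apply csum_Cmod_le.
Qed.

(** The averages over radius [r] and over a small radius [s] are close by
    [mean_radial_step], and the latter are close to [F 0] by continuity. *)
Lemma holomorphic_mean_value (F : C -> C) (r : R) :
  holomorphic F -> 0 < r < 1 -> mean_lim (fun zeta => F (r * zeta)%C) (F 0).
Proof.
  intros HF Hr eps Heps.
  set (e := eps / 4). assert (He : 0 < e) by (unfold e; lra).
  destruct (holomorphic_uniform F r e HF Hr He) as (d & Hd & HL).
  assert (H0 : disk 0) by (unfold disk; rewrite Cmod_0; lra).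
  destruct (HF 0 H0) as [L0 HL0].
  destruct (strict_derivative_near_value _ _ _ e HL0 He) as (d0 & Hd0 & Hc).
  set (s := Rmin (d0 / 2) r).
  assert (Hs0 : s <= d0 / 2) by apply Rmin_l.
  assert (Hsr : s <= r) by apply Rmin_r.
  assert (Hs : 0 < s) by (apply Rmin_pos; lra).
  destruct (root_near_1 d Hd) as [M HM].
  exists (S M). intros m Hm.
  specialize (HM m ltac:(lia)).
  set (A := fun t : R => mean m (fun zeta => F (t * zeta)%C)).
  assert (H1 : Cmod (A r - A s) <= 2 * e * (r - s)).
  { apply local_lipschitz_global with d; try lra.
    intros t t' Ht Ht' Htt. apply mean_radial_step with d; try assumption; try lra; [lia| |].
    - intros z Hz; apply HL; lra.
    - apply Rle_lt_trans with (1 * Cmod (root m - 1)); [|lra].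
      apply Rmult_le_compat_r; [apply Cmod_ge_0|lra]. }
  assert (H2 : Cmod (A s - F 0) <= e).
  { rewrite <- (mean_const m (F 0)). apply Cmod_mean_diff_le. intros zeta Hz.
    apply Rlt_le.
    assert (Hn : Cmod (s * zeta - 0) < d0).
    { replace (s * zeta - 0)%C with (s * zeta)%C by ring.
      rewrite Cmod_mult, Cmod_R, Hz, Rabs_right by lra. lra. }
    apply (Hc _ _ Hn Hn). }
  pose proof (Cmod_triangle_sub (A r) (A s) (F 0)) as H3.
  assert (H4 : 2 * e * (r - s) <= 2 * e * 1) by (apply Rmult_le_compat_l; lra).
  change (mean m (fun zeta => F (r * zeta)%C)) with (A r).
  unfold e in *. lra.
Qed.


(** * Finite Taylor expansions *)

(** Only the remainder of the last stage is required to be holomorphic; [c k] is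
    unconstrained for [k >= N]. *)
Fixpoint taylor (N : nat) (c : nat -> C) (F : C -> C) : Prop :=
  match N with
  | O => holomorphic F
  | S n => exists K : C -> C,
      (forall z, disk z -> F z = (c O + z * K z)%C) /\
      taylor n (fun k => c (S k)) K
  end.

Lemma taylor_ext (N : nat) (c d : nat -> C) (F G : C -> C) :
  (forall k, c k = d k) -> (forall z, disk z -> F z = G z) ->
  taylor N c F -> taylor N d G.
Proof.
  revert c d F G; induction N as [|N IH]; intros c d F G Hc HF; simpl.
  - now apply holomorphic_ext.
  - intros (K & HK & HT); exists K; split.
    + intros z Hz. rewrite <- HF, HK, Hc by exact Hz; reflexivity.
    + apply (IH _ _ K K (fun k => Hc (S k)) (fun z _ => eq_refl) HT).
Qed.

Lemma taylor_holomorphic (N : nat) (c : nat -> C) (F : C -> C) :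
  taylor N c F -> holomorphic F.
Proof.
  revert c F; induction N as [|N IH]; intros c F; simpl; [auto|].
  intros (K & HK & HT). apply IH in HT.
  apply holomorphic_ext with (fun z => c O + z * K z)%C.
  - intros z Hz; symmetry; auto.
  - apply holomorphic_plus; [apply holomorphic_const|].
    apply holomorphic_mult; [apply holomorphic_id|exact HT].
Qed.

Lemma taylor_pred (N : nat) (c : nat -> C) (F : C -> C) :
  taylor (S N) c F -> taylor N c F.
Proof.
  revert c F; induction N as [|N IH]; intros c F H.
  - exact (taylor_holomorphic _ _ _ H).
  - destruct H as (K & HK & HT); exists K; split; [exact HK|]. now apply IH.
Qed.

Lemma taylor_0 (N : nat) : taylor N (fun _ => RtoC 0) (fun _ => RtoC 0).
Proof.
  induction N as [|N IH]; simpl; [apply holomorphic_const|].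
  exists (fun _ => RtoC 0); split; [intros; ring|exact IH].
Qed.

Definition const_coef (a : C) (k : nat) : C := match k with O => a | S _ => 0 end.

Lemma taylor_const (N : nat) (a : C) : taylor N (const_coef a) (fun _ => a).
Proof.
  destruct N as [|N]; simpl; [apply holomorphic_const|].
  exists (fun _ => RtoC 0); split; [intros; simpl; ring|apply taylor_0].
Qed.

Lemma taylor_lin (N : nat) (a : C) (c d : nat -> C) (F G : C -> C) :
  taylor N c F -> taylor N d G ->
  taylor N (fun k => c k + a * d k)%C (fun z => F z + a * G z)%C.
Proof.
  revert c d F G; induction N as [|N IH]; intros c d F G; simpl.
  - intros HF HG. apply holomorphic_plus; [exact HF|].
    apply (holomorphic_mult (fun _ => a)); [apply holomorphic_const|exact HG].
  - intros (K & HK & HT) (L & HL & HU).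
    exists (fun z => K z + a * L z)%C; split.
    + intros z Hz. rewrite HK, HL by exact Hz. ring.
    + exact (IH _ _ _ _ HT HU).
Qed.

Fixpoint conv (c d : nat -> C) (n : nat) : C :=
  match n with
  | O => c O * d O
  | S m => c O * d (S m) + conv (fun k => c (S k)) d m
  end.

(** [(c + z K) G = c (d + z L) + z K G]: the product of order [N] needs [G] both
    as a whole and with its first coefficient removed. *)
Lemma taylor_mult (N : nat) (c d : nat -> C) (F G : C -> C) :
  taylor N c F -> taylor N d G -> taylor N (conv c d) (fun z => F z * G z)%C.
Proof.
  revert c d F G; induction N as [|N IH]; intros c d F G; simpl.
  - apply holomorphic_mult.
  - intros (K & HK & HT) HG. pose proof (taylor_pred _ _ _ HG) as HG'.
    destruct HG as (L & HL & HU).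
    exists (fun z => K z * G z + c O * L z)%C; split.
    + intros z Hz. rewrite HK, HL by exact Hz. ring.
    + apply taylor_ext with (fun k => conv (fun k => c (S k)) d k + c O * d (S k))%C
        (fun z => K z * G z + c O * L z)%C; [intros; ring|reflexivity|].
      apply taylor_lin; [apply IH; assumption|exact HU].
Qed.

Lemma taylor_inv (N : nat) (c : nat -> C) (F : C -> C) :
  taylor N c F -> (forall z, disk z -> F z <> 0) ->
  exists d, taylor N d (fun z => / F z)%C.
Proof.
  intros HF H0. revert c HF; induction N as [|N IH]; intros c HF.
  - exists c. now apply holomorphic_inv.
  - destruct (IH c (taylor_pred _ _ _ HF)) as [d Hd].
    destruct HF as (K & HK & HT).
    (* 1/(c + zK) = 1/c - z K / (c F) *)
    assert (Hc : c O <> 0).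
    { assert (D0 : disk 0) by (unfold disk; rewrite Cmod_0; lra).
      intros E; apply (H0 0 D0). rewrite HK by exact D0. rewrite E; ring. }
    pose proof (taylor_lin N (- / c O) _ _ _ _ (taylor_0 N) (taylor_mult _ _ _ _ _ HT Hd)) as H.
    match type of H with taylor _ ?e ?K' =>
      exists (fun k => match k with O => / c O | S j => e j end)%C; exists K' end.
    split; [|exact H].
    intros z Hz. specialize (H0 z Hz). rewrite HK in * by exact Hz. field; auto.
Qed.

(** If [W = z W1], then [c + W K(W) = c + z (W1 K(W))]: the order of the
    composition grows by one without composing any series. *)
Lemma taylor_comp (N : nat) (c w : nat -> C) (F W : C -> C) :
  taylor N c F -> taylor N w W -> w O = 0 -> (forall z, disk z -> disk (W z)) ->
  exists d, d O = c O /\ taylor N d (fun z => F (W z)).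
Proof.
  intros HF HW Hw HD. revert c F HF HW; induction N as [|N IH]; intros c F HF HW.
  - exists c; split; [reflexivity|now apply holomorphic_comp].
  - pose proof (taylor_pred _ _ _ HW) as HW'.
    destruct HF as (K & HK & HT). destruct HW as (W1 & HW1 & HU).
    destruct (IH _ _ HT HW') as (e & _ & He).
    exists (fun k => match k with O => c O | S j => conv (fun k => w (S k)) e j end).
    split; [reflexivity|].
    exists (fun z => W1 z * K (W z))%C; split; [|now apply taylor_mult].
    intros z Hz. rewrite HK by auto. rewrite HW1 at 1 by exact Hz. rewrite Hw. ring.
Qed.

Fixpoint polynomial (N : nat) (c : nat -> C) (z : C) : C :=
  match N with O => 0 | S n => c O + z * polynomial n (fun k => c (S k)) z end.

Lemma taylor_poly (N : nat) (c : nat -> C) : taylor N c (polynomial N c).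
Proof.
  revert c; induction N as [|N IH]; intros c; simpl.
  - apply holomorphic_const.
  - exists (polynomial N (fun k => c (S k))); split; [reflexivity|apply IH].
Qed.

Lemma taylor_remainder (N : nat) (c : nat -> C) (F : C -> C) :
  taylor N c F -> exists K, holomorphic K /\
    forall z, disk z -> F z = (polynomial N c z + z ^ N * K z)%C.
Proof.
  revert c F; induction N as [|N IH]; intros c F; simpl.
  - intros HF; exists F; split; [exact HF|intros; ring].
  - intros (K & HK & HT). destruct (IH _ _ HT) as (R & HR & HE).
    exists R; split; [exact HR|]. intros z Hz. rewrite HK, HE by exact Hz. ring.
Qed.

(** * Coefficients as limits of means *)

Lemma Cconj_0 : Cconj 0 = 0.
Proof. unfold Cconj, RtoC; simpl; f_equal; ring. Qed.

Lemma Cconj_mult_unit (zeta : C) : Cmod zeta = 1 -> (Cconj zeta * zeta = 1)%C.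
Proof.
  intros H. rewrite Cmult_comm, <- Cmod2_conj, H. f_equal. ring.
Qed.

Lemma disk_scal (r : R) (zeta : C) : 0 < r < 1 -> Cmod zeta = 1 -> disk (r * zeta).
Proof.
  intros Hr Hz. unfold disk. rewrite Cmod_mult, Cmod_R, Hz, Rabs_right; lra.
Qed.

Lemma mean_lim_high (n : nat) (F : C -> C) (r : R) :
  holomorphic F -> 0 < r < 1 ->
  mean_lim (fun zeta => zeta ^ S n * F (r * zeta))%C 0.
Proof.
  intros HF Hr.
  assert (Hr0 : RtoC r <> 0) by (intros E; apply RtoC_inj in E; lra).
  assert (HG : holomorphic (fun z => z ^ S n * F z)%C).
  { apply (holomorphic_mult (fun z => z ^ S n)%C); [|exact HF].
    apply (holomorphic_pow (fun z => z)), holomorphic_id. }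
  (* the function [z^(n+1) F z] vanishes at [0]; dividing by [r^(n+1)] rescales the circle *)
  pose proof (mean_lim_scal (/ r ^ S n) _ _ (holomorphic_mean_value _ r HG Hr)) as H.
  replace (/ r ^ S n * (0 ^ S n * F 0))%C with (RtoC 0) in H by (rewrite (Cpow_S 0 n); ring).
  revert H; apply mean_lim_ext; intros zeta _.
  rewrite Cpow_mult_l. field. now apply Cpow_nz.
Qed.

Lemma mean_lim_pow (n : nat) : mean_lim (fun zeta => zeta ^ S n)%C 0.
Proof.
  apply mean_lim_ext with (fun zeta => zeta ^ S n * 1)%C; [intros; ring|].
  apply (mean_lim_high n (fun _ => RtoC 1) (1 / 2));
    [apply holomorphic_const|lra].
Qed.

(** On the unit circle [conj zeta * zeta = 1], so multiplying [c_0 + z K] by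
    [conj zeta ^ (n+1)] leaves a pure negative power, of mean zero, and [r] times
    the same problem for [K] at order [n]. *)
Lemma mean_lim_coef (N : nat) (c : nat -> C) (F : C -> C) (n : nat) (r : R) :
  taylor N c F -> (n < N)%nat -> 0 < r < 1 ->
  mean_lim (fun zeta => Cconj zeta ^ n * F (r * zeta))%C (c n * r ^ n)%C.
Proof.
  intros HF Hn Hr. revert N c F HF Hn; induction n as [|n IH]; intros N c F HF Hn.
  - pose proof (taylor_holomorphic _ _ _ HF) as Hh.
    destruct N as [|N]; [lia|]. destruct HF as (K & HK & _).
    assert (E : (F 0 = c O * r ^ 0)%C).
    { rewrite HK by (unfold disk; rewrite Cmod_0; lra). simpl Cpow. ring. }
    rewrite <- E.
    apply mean_lim_ext with (fun zeta => F (r * zeta)%C);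
      [intros; simpl; ring|now apply holomorphic_mean_value].
  - destruct N as [|N]; [lia|]. destruct HF as (K & HK & HT).
    specialize (IH N _ K HT ltac:(lia)).
    pose proof (mean_lim_scal (c O) _ _ (mean_lim_conj _ _ (mean_lim_pow n))) as H0.
    pose proof (mean_lim_lin r _ _ _ _ H0 IH) as H. rewrite Cconj_0 in H.
    replace (c O * 0 + r * (c (S n) * r ^ n))%C with (c (S n) * r ^ S n)%C in H
      by (rewrite Cpow_S; ring).
    revert H; apply mean_lim_ext; intros zeta Hz.
    rewrite HK by now apply disk_scal.
    pose proof (Cconj_mult_unit zeta Hz) as Hu.
    rewrite Cpow_conj, Cpow_S.
    replace (Cconj zeta * Cconj zeta ^ n * (c O + r * zeta * K (r * zeta)))%C
      with (c O * (Cconj zeta * Cconj zeta ^ n)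
            + r * ((Cconj zeta * zeta) * (Cconj zeta ^ n * K (r * zeta))))%C by ring.
    rewrite Hu. ring.
Qed.

(** Both coefficients are the same limit of averages. *)
Lemma taylor_unique (N : nat) (c d : nat -> C) (F : C -> C) (n : nat) :
  taylor N c F -> taylor N d F -> (n < N)%nat -> c n = d n.
Proof.
  intros Hc Hd Hn. assert (Hr : 0 < 1 / 2 < 1) by lra.
  pose proof (mean_lim_unique _ _ _ (mean_lim_coef _ _ _ _ _ Hc Hn Hr)
    (mean_lim_coef _ _ _ _ _ Hd Hn Hr)) as H.
  assert (Hz : ((1 / 2)%R ^ n)%C <> 0)
    by (apply Cpow_nz; intros E; apply RtoC_inj in E; lra).
  replace (c n) with (c n * (1 / 2)%R ^ n / (1 / 2)%R ^ n)%C by (field; exact Hz).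
  rewrite H. field; exact Hz.
Qed.

(** * Coefficient inequalities *)

Lemma unit_rotation (w : C) : exists alpha : C, Cmod alpha = 1 /\ (alpha * w)%C = Cmod w.
Proof.
  destruct (classic (w = 0)) as [E|E].
  - exists 1; split; [apply Cmod_1|]. rewrite E, Cmod_0; ring.
  - assert (Hm : RtoC (Cmod w) <> 0).
    { intros H; apply RtoC_inj in H. now apply Cmod_eq_0 in H. }
    exists (Cconj w / Cmod w)%C; split.
    + rewrite Cmod_div, Cmod_conj, Cmod_R, Rabs_right by (auto; apply Rle_ge, Cmod_ge_0).
      apply Rinv_r. intros H; apply Hm; now rewrite H.
    + replace (Cconj w / Cmod w * w)%C with ((w * Cconj w) / Cmod w)%C by (field; auto).
      rewrite <- Cmod2_conj, RtoC_pow. field. exact Hm.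
Qed.

Lemma bernoulli_sub (t : R) (n : nat) : 0 <= t <= 1 -> 1 - INR n * t <= (1 - t) ^ n.
Proof.
  intros Ht. induction n as [|n IH]; [simpl; lra|].
  rewrite S_INR; simpl pow. pose proof (pos_INR n). nra.
Qed.

(** Lets the radius tend to 1 in a coefficient estimate. *)
Lemma le_of_pow_scaled (x B : R) (n : nat) :
  0 <= x -> (forall r, 0 < r < 1 -> x * r ^ n <= B) -> x <= B.
Proof.
  intros Hx H. apply Rnot_lt_le; intros Hlt.
  pose proof (pos_INR n) as Hn.
  set (t := (x - B) / (2 * (x * (INR n + 1) + (x - B)))).
  assert (Hden : 0 < 2 * (x * (INR n + 1) + (x - B))) by nra.
  assert (Ht : 0 < t < 1).
  { split; [apply Rdiv_lt_0_compat; lra|]. apply Rlt_div_l; [lra|]. nra. }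
  specialize (H (1 - t) ltac:(lra)). pose proof (bernoulli_sub t n ltac:(lra)) as Hber.
  assert (Htt : t * (2 * (x * (INR n + 1) + (x - B))) = x - B) by (unfold t; field; lra).
  assert (x * (1 - INR n * t) <= x * (1 - t) ^ n) by (apply Rmult_le_compat_l; lra).
  assert (0 <= x * t) by (apply Rmult_le_pos; lra).
  nra.
Qed.

(** [conj zeta ^ n * conj F] is the conjugate of [zeta ^ n * F], of mean zero, so
    [p_n r^n] is a limit of averages of [conj zeta ^ n * 2 Re F].  Since [Re F] is
    nonnegative, these are at most the averages of [2 Re F] in modulus. *)
Lemma caratheodory (N : nat) (p : nat -> C) (F : C -> C) (n : nat) :
  taylor N p F -> (forall z, disk z -> 0 <= Re (F z)) -> (0 < n < N)%nat ->
  Cmod (p n) <= 2 * Re (p O).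
Proof.
  intros HF Hpos Hn. apply le_of_pow_scaled with n; [apply Cmod_ge_0|]. intros r Hr.
  destruct n as [|n]; [lia|].
  destruct (unit_rotation (p (S n))) as (alpha & Ha & Hap).
  pose proof (mean_lim_coef _ _ _ (S n) r HF ltac:(lia) Hr) as H1.
  pose proof (mean_lim_conj _ _ (mean_lim_high n F r (taylor_holomorphic _ _ _ HF) Hr)) as H2.
  pose proof (mean_lim_scal alpha _ _ (mean_lim_plus _ _ _ _ H1 H2)) as H3.
  pose proof (mean_lim_scal 2 _ _ (mean_lim_coef _ _ _ O r HF ltac:(lia) Hr)) as H4.
  rewrite Cconj_0 in H3.
  replace (alpha * (p (S n) * r ^ S n + 0))%C with (RtoC (Cmod (p (S n)) * r ^ S n)) in H3
    by (rewrite RtoC_mult, RtoC_pow, <- Hap; ring).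
  replace (2 * (p O * r ^ 0))%C with (2 * p O)%C in H4 by (simpl; ring).
  pose proof (fun K => mean_lim_re_le _ _ _ _ K H3 H4) as H.
  rewrite re_RtoC, re_scal_l in H. apply H; clear H.
  intros zeta Hz.
  rewrite Cmult_conj, Cpow_conj, <- Cmult_plus_distr_l.
  specialize (Hpos _ (disk_scal r zeta Hr Hz)).
  set (f := F (r * zeta)%C) in *.
  replace (f + Cconj f)%C with (RtoC (2 * Re f))
    by (rewrite RtoC_mult, re_alt; field).
  replace (2 * (Cconj zeta ^ 0 * f))%C with (RtoC 2 * f)%C by (simpl; ring).
  rewrite re_scal_l.
  set (u := (Cconj zeta ^ S n)%C).
  assert (Hu : Cmod u = 1) by (unfold u; rewrite Cmod_pow, Cmod_conj, Hz; apply pow1).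
  rewrite Cmult_assoc, re_scal_r.
  pose proof (re_le_Cmod (alpha * u)) as Hre. rewrite Cmod_mult, Ha, Hu in Hre.
  apply Rabs_le_between in Hre. nra.
Qed.


(** * Finite sums of real numbers *)

Fixpoint psum (x : nat -> R) (n : nat) : R :=
  match n with O => 0 | S k => psum x k + x k end.

Lemma psum_S_l (x : nat -> R) (n : nat) :
  psum x (S n) = x O + psum (fun k => x (S k)) n.
Proof.
  induction n as [|n IH]; [simpl; ring|].
  change (psum x (S (S n))) with (psum x (S n) + x (S n)). rewrite IH. simpl; ring.
Qed.

Lemma psum_le (x y : nat -> R) (n : nat) :
  (forall k, (k < n)%nat -> x k <= y k) -> psum x n <= psum y n.
Proof.
  induction n as [|n IH]; intros H; simpl; [lra|].
  pose proof (H n ltac:(lia)). pose proof (IH ltac:(intros; apply H; lia)). lra.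
Qed.

Lemma psum_ext (x y : nat -> R) (n : nat) :
  (forall k, x k = y k) -> psum x n = psum y n.
Proof. intros H; induction n as [|n IH]; simpl; [|rewrite IH, H]; reflexivity. Qed.

Lemma psum_ge_0 (x : nat -> R) (n : nat) : (forall k, 0 <= x k) -> 0 <= psum x n.
Proof. intros H; induction n as [|n IH]; simpl; [lra|]. specialize (H n); lra. Qed.

Lemma psum_scal (a : R) (x : nat -> R) (n : nat) :
  psum (fun k => a * x k) n = a * psum x n.
Proof. induction n as [|n IH]; simpl; [|rewrite IH]; ring. Qed.

Lemma psum_plus (x y : nat -> R) (n : nat) :
  psum (fun k => x k + y k) n = psum x n + psum y n.
Proof. induction n as [|n IH]; simpl; [|rewrite IH]; ring. Qed.

(** Summation by parts: with nonincreasing weights, domination of all partial sums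
    is inherited by the weighted sums.  The induction needs the stronger claim
    that the difference is at least the last weight times the unweighted
    difference. *)
Lemma psum_abel (w x y : nat -> R) (n : nat) :
  (forall k, 0 <= w (S k) <= w k) ->
  (forall k, psum x k <= psum y k) ->
  psum (fun k => w k * x k) n <= psum (fun k => w k * y k) n.
Proof.
  intros Hw Hxy.
  assert (H : forall k, w k * (psum y (S k) - psum x (S k))
     <= psum (fun k => w k * y k) (S k) - psum (fun k => w k * x k) (S k)).
  { induction k as [|k IH]; [simpl; lra|].
    change (psum (fun k => w k * y k) (S (S k)))
      with (psum (fun k => w k * y k) (S k) + w (S k) * y (S k)).
    change (psum (fun k => w k * x k) (S (S k)))
      with (psum (fun k => w k * x k) (S k) + w (S k) * x (S k)).
    change (psum y (S (S k))) with (psum y (S k) + y (S k)).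
    change (psum x (S (S k))) with (psum x (S k) + x (S k)).
    specialize (Hw k). specialize (Hxy (S k)).
    assert (w (S k) * (psum y (S k) - psum x (S k)) <= w k * (psum y (S k) - psum x (S k)))
      by (apply Rmult_le_compat_r; lra).
    lra. }
  destruct n as [|n]; [simpl; lra|].
  specialize (H n). specialize (Hxy (S n)).
  assert (0 <= w n) by (specialize (Hw n); lra).
  assert (0 <= w n * (psum y (S n) - psum x (S n))) by (apply Rmult_le_pos; lra).
  lra.
Qed.

Lemma psum_geom_le (r : R) (n : nat) : 0 <= r < 1 ->
  psum (fun k => r ^ S k) n <= r / (1 - r).
Proof.
  intros Hr. apply Rle_trans with (r / (1 - r) * (1 - r ^ n)).
  - right. induction n as [|n IH]; [simpl; ring|].
    cbn [psum]. rewrite IH. simpl pow. field. lra.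
  - rewrite <- (Rmult_1_r (r / (1 - r))) at 2.
    apply Rmult_le_compat_l; [apply Rdiv_le_0_compat; lra|].
    pose proof (pow_le r n ltac:(lra)). lra.
Qed.

(** * Multiplication by a bounded function *)

Lemma poly_csum (N : nat) (c : nat -> C) (z : C) :
  polynomial N c z = csum (fun k => c k * z ^ k)%C N.
Proof.
  revert c; induction N as [|N IH]; intros c; [reflexivity|].
  rewrite csum_S_l. simpl polynomial. rewrite IH. simpl Cpow at 2. f_equal; [ring|].
  clear. induction N as [|N IH]; simpl; [ring|]. simpl in IH. rewrite <- IH. ring.
Qed.

(** Parseval's identity for a polynomial against a function of known
    coefficients. *)
Lemma mean_lim_conj_poly (N : nat) (a b : nat -> C) (v : C -> C) (r : R) :
  (forall n, (n < N)%nat -> mean_lim (fun zeta => Cconj zeta ^ n * v zeta)%C (b n * r ^ n)%C) ->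
  mean_lim (fun zeta => Cconj (polynomial N a (r * zeta)) * v zeta)%C
    (csum (fun n => Cconj (a n) * b n * r ^ (2 * n))%C N).
Proof.
  intros H. apply mean_lim_ext with
    (fun zeta => Cconj (csum (fun k => a k * (r * zeta) ^ k) N) * v zeta)%C.
  { intros zeta _; now rewrite poly_csum. }
  induction N as [|N IH].
  - apply mean_lim_ext with (fun _ => RtoC 0); [|apply mean_lim_const].
    intros; simpl. rewrite Cconj_0; ring.
  - specialize (IH ltac:(intros; apply H; lia)).
    pose proof (mean_lim_lin (Cconj (a N) * r ^ N) _ _ _ _ IH (H N ltac:(lia))) as H1.
    replace (2 * N)%nat with (N + N)%nat in H1 by lia.
    simpl csum. replace (N + (N + 0))%nat with (N + N)%nat by lia.
    rewrite Cpow_add_r.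
    replace (Cconj (a N) * r ^ N * (b N * r ^ N))%C
      with (Cconj (a N) * b N * (r ^ N * r ^ N))%C in H1 by ring.
    revert H1; apply mean_lim_ext; intros zeta _.
    rewrite Cplus_conj, Cmult_conj, Cpow_conj, Cmult_conj, Cpow_mult_l.
    replace (Cconj r) with (RtoC r) by (unfold Cconj, RtoC; simpl; f_equal; ring).
    ring.
Qed.

Lemma csum_norm (a : nat -> C) (r : R) (N : nat) :
  csum (fun n => Cconj (a n) * a n * r ^ (2 * n))%C N
  = RtoC (psum (fun n => Cmod (a n) ^ 2 * r ^ (2 * n)) N).
Proof.
  induction N as [|N IH]; [reflexivity|].
  cbn [csum psum]. rewrite IH, RtoC_plus, RtoC_mult, Cmod2_conj, RtoC_pow. ring.
Qed.

(** With [p] and [q] the truncations of [H] and [G] on the circle of radius [r], the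
    function [v = Phi q] has the same coefficients as [H] up to order [N].  Hence
    the averages of [conj p * v] and of [|p|^2] both tend to the left-hand side,
    whereas [|v| <= |q|] pointwise. *)
Lemma rogosinski (N : nat) (a d : nat -> C) (H Phi G : C -> C) (r : R) :
  taylor N a H -> taylor N d G -> holomorphic Phi ->
  (forall z, disk z -> H z = (Phi z * G z)%C) ->
  (forall z, disk z -> Cmod (Phi z) <= 1) -> 0 < r < 1 ->
  psum (fun n => Cmod (a n) ^ 2 * r ^ (2 * n)) N
    <= psum (fun n => Cmod (d n) ^ 2 * r ^ (2 * n)) N.
Proof.
  intros Ha Hd HPhi HH HB Hr.
  set (p := fun zeta => polynomial N a (r * zeta)).
  set (q := fun zeta => polynomial N d (r * zeta)).
  set (v := fun zeta => (Phi (r * zeta) * q zeta)%C).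
  assert (Hv : forall n, (n < N)%nat ->
            mean_lim (fun zeta => Cconj zeta ^ n * v zeta)%C (a n * r ^ n)%C).
  { intros n Hn. destruct (taylor_remainder _ _ _ Hd) as (K & HK & HE).
    pose proof (mean_lim_high (N - S n) (fun z => Phi z * K z)%C r
      (holomorphic_mult _ _ HPhi HK) Hr) as H1.
    pose proof (mean_lim_lin (- r ^ N) _ _ _ _ (mean_lim_coef _ _ _ _ _ Ha Hn Hr) H1) as H2.
    replace (a n * r ^ n + - r ^ N * 0)%C with (a n * r ^ n)%C in H2 by ring.
    revert H2; apply mean_lim_ext; intros zeta Hz.
    unfold v, q. pose proof (disk_scal r zeta Hr Hz) as Hdz.
    rewrite HH, HE by exact Hdz. rewrite Cpow_mult_l.
    assert (Hpow : (Cconj zeta ^ n * zeta ^ N = zeta ^ S (N - S n))%C).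
    { replace N with (n + S (N - S n))%nat at 1 by lia.
      rewrite Cpow_add_r, Cmult_assoc, <- Cpow_mult_l, Cconj_mult_unit, Cpow_1_l by exact Hz.
      ring. }
    rewrite <- Hpow. ring. }
  pose proof (mean_lim_conj_poly N a a v r Hv) as M1.
  pose proof (mean_lim_conj_poly N a a p r
    (fun n Hn => mean_lim_coef _ _ _ _ _ (taylor_poly N a) Hn Hr)) as M2.
  pose proof (mean_lim_conj_poly N d d q r
    (fun n Hn => mean_lim_coef _ _ _ _ _ (taylor_poly N d) Hn Hr)) as M3.
  rewrite csum_norm in M1, M2, M3.
  set (A := psum (fun n => Cmod (a n) ^ 2 * r ^ (2 * n)) N) in *.
  (* 2 Re (conj p v) - |p|^2 <= |v|^2 <= |q|^2, since |v - p|^2 >= 0 *)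
  pose proof (mean_lim_lin (-(1)) _ _ _ _ (mean_lim_scal 2 _ _ M1) M2) as M4.
  pose proof (fun K => mean_lim_re_le _ _ _ _ K M4 M3) as Hle.
  replace (2 * A + - (1) * A)%C with (RtoC A) in Hle by ring.
  rewrite !re_RtoC in Hle. apply Hle; clear Hle.
  intros zeta Hz. unfold v.
  pose proof (HB _ (disk_scal r zeta Hr Hz)) as HPz.
  set (f := Phi (r * zeta)%C) in *. fold (p zeta) (q zeta).
  generalize dependent (p zeta). generalize dependent (q zeta). clear - HPz.
  intros Q P.
  assert (HfQ : Cmod (f * Q) ^ 2 <= Cmod Q ^ 2).
  { apply pow_incr; split; [apply Cmod_ge_0|]. rewrite Cmod_mult.
    rewrite <- (Rmult_1_l (Cmod Q)) at 2.
    apply Rmult_le_compat_r; [apply Cmod_ge_0|exact HPz]. }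
  rewrite !Cmod2_alt in HfQ.
  generalize dependent (f * Q)%C. intros w Hw.
  destruct w as [x y], P as [s t], Q as [k l].
  unfold Re, Im, Cconj, Cplus, Cmult, Copp, RtoC in *; simpl in *.
  pose proof (Rle_0_sqr (x - s)) as S1. pose proof (Rle_0_sqr (y - t)) as S2.
  unfold Rsqr in *. lra.
Qed.

Lemma conv_abs_sum (N : nat) (c d : nat -> C) (r : R) : 0 <= r ->
  psum (fun k => Cmod (conv c d k) * r ^ k) N
    <= psum (fun k => Cmod (c k) * r ^ k) N * psum (fun k => Cmod (d k) * r ^ k) N.
Proof.
  intros Hr.
  assert (Hnn : forall (e : nat -> C) k, 0 <= Cmod (e k) * r ^ k)
    by (intros; apply Rmult_le_pos; [apply Cmod_ge_0|now apply pow_le]).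
  assert (Hshift : forall (e : nat -> C) M,
    psum (fun k => Cmod (e (S k)) * r ^ S k) M = r * psum (fun k => Cmod (e (S k)) * r ^ k) M).
  { intros; rewrite <- psum_scal; apply psum_ext; intros; simpl; ring. }
  revert c; induction N as [|N IH]; intros c; [simpl; lra|].
  set (E := psum (fun k => Cmod (d k) * r ^ k) N) in *.
  set (E' := psum (fun k => Cmod (d k) * r ^ k) (S N)) in *.
  assert (HE : E <= E') by (unfold E, E'; cbn [psum]; specialize (Hnn d N); lra).
  rewrite psum_S_l, (psum_S_l (fun k => Cmod (c k) * r ^ k)), !Hshift.
  specialize (IH (fun k => c (S k))). simpl conv.
  set (T := psum (fun k => Cmod (c (S k)) * r ^ k) N) in *.
  assert (HT : 0 <= T) by (apply psum_ge_0; intros k; apply (Hnn (fun k => c (S k)))).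
  set (D1 := psum (fun k => Cmod (d (S k)) * r ^ k) N).
  assert (HD : E' = Cmod (d O) + r * D1).
  { unfold E', D1. rewrite psum_S_l, Hshift. simpl pow; ring. }
  assert (Hstep : psum (fun k => Cmod (c O * d (S k) + conv (fun k => c (S k)) d k) * r ^ k) N
            <= Cmod (c O) * D1 + T * E).
  { unfold D1. eapply Rle_trans; [|apply Rplus_le_compat_l, IH].
    rewrite <- psum_scal, <- psum_plus. apply psum_le; intros k _.
    pose proof (pow_le r k Hr).
    eapply Rle_trans; [apply Rmult_le_compat_r; [lra|apply Cmod_triangle]|].
    rewrite Cmod_mult. lra. }
  rewrite Cmod_mult. simpl pow. pose proof (Cmod_ge_0 (c O)) as Hc.
  assert (Hr2 : r * psum (fun k => Cmod (c O * d (S k) + conv (fun k => c (S k)) d k) * r ^ k) N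
     <= r * (Cmod (c O) * D1 + T * E)) by (apply Rmult_le_compat_l; lra).
  assert (Hr3 : r * (T * E) <= r * (T * E'))
    by (apply Rmult_le_compat_l; [lra|apply Rmult_le_compat_l; lra]).
  rewrite HD in *. lra.
Qed.

(** Caratheodory's inequality for [1 - alpha Phi] gives
    [|c_n| <= 2 (1 - |c_0|)], and [2 r/(1-r) <= 1] for [r <= 1/3]. *)
Lemma bohr (N : nat) (c : nat -> C) (Phi : C -> C) (r : R) :
  taylor N c Phi -> (forall z, disk z -> Cmod (Phi z) <= 1) -> 0 <= r <= 1 / 3 ->
  psum (fun k => Cmod (c k) * r ^ k) N <= 1.
Proof.
  intros HT HB Hr. destruct N as [|N]; [simpl; lra|].
  destruct (unit_rotation (c O)) as (alpha & Ha & Hac).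
  pose proof (taylor_lin (S N) (- alpha) _ _ _ _ (taylor_const (S N) 1) HT) as HF.
  assert (Hpos : forall z, disk z -> 0 <= Re (1 + - alpha * Phi z)%C).
  { intros z Hz. specialize (HB z Hz).
    pose proof (re_le_Cmod (alpha * Phi z)) as H. rewrite Cmod_mult, Ha in H.
    apply Rabs_le_between in H.
    replace (1 + - alpha * Phi z)%C with (1 - alpha * Phi z)%C by ring.
    unfold Re in *; simpl in *. lra. }
  assert (H0 : 0 <= Cmod (c O) <= 1).
  { split; [apply Cmod_ge_0|]. destruct HT as (K & HK & _).
    assert (D0 : disk 0) by (unfold disk; rewrite Cmod_0; lra).
    specialize (HB 0 D0). rewrite HK in HB by exact D0.
    now replace (c O + 0 * K 0)%C with (c O) in HB by ring. }
  assert (Hc : forall k, (k < N)%nat -> Cmod (c (S k)) <= 2 * (1 - Cmod (c O))).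
  { intros k Hk. pose proof (caratheodory _ _ _ (S k) HF Hpos ltac:(lia)) as H.
    cbn [const_coef] in H.
    replace (1 + - alpha * c O)%C with (RtoC (1 - Cmod (c O))) in H
      by (rewrite RtoC_minus, <- Hac; ring).
    replace (0 + - alpha * c (S k))%C with (- (alpha * c (S k)))%C in H by ring.
    now rewrite Cmod_opp, Cmod_mult, Ha, Rmult_1_l, re_RtoC in H. }
  rewrite psum_S_l. simpl (r ^ 0).
  assert (Hs : psum (fun k => Cmod (c (S k)) * r ^ S k) N
             <= 2 * (1 - Cmod (c O)) * (r / (1 - r))).
  { eapply Rle_trans; [|apply Rmult_le_compat_l; [lra|apply psum_geom_le; lra]].
    rewrite <- psum_scal. apply psum_le; intros k Hk.
    apply Rmult_le_compat_r; [apply pow_le; lra|auto]. }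
  assert (Hq : r / (1 - r) <= 1 / 2) by (apply Rle_div_l; lra).
  nra.
Qed.

Lemma bohr_majorant (N : nat) (a c d : nat -> C) (H Phi G : C -> C) (r : R) :
  taylor N a H -> taylor N c Phi -> taylor N d G ->
  (forall z, disk z -> H z = (Phi z * G z)%C) ->
  (forall z, disk z -> Cmod (Phi z) <= 1) -> 0 <= r <= 1 / 3 ->
  psum (fun k => Cmod (a k) * r ^ k) N <= psum (fun k => Cmod (d k) * r ^ k) N.
Proof.
  intros Ha Hc Hd HH HB Hr.
  pose proof (taylor_mult _ _ _ _ _ Hc Hd) as Hm.
  assert (Ha' : taylor N a (fun z => Phi z * G z)%C)
    by now apply taylor_ext with a H.
  apply Rle_trans with (psum (fun k => Cmod (conv c d k) * r ^ k) N).
  - apply psum_le; intros k Hk.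
    rewrite (taylor_unique _ _ _ _ _ Ha' Hm Hk). lra.
  - eapply Rle_trans; [apply conv_abs_sum; lra|].
    rewrite <- (Rmult_1_l (psum (fun k => Cmod (d k) * r ^ k) N)) at 2.
    apply Rmult_le_compat_r; [|now apply bohr with Phi].
    apply psum_ge_0; intros k. apply Rmult_le_pos; [apply Cmod_ge_0|apply pow_le; lra].
Qed.


(** * Convergent complex series *)

Definition csum_lim (u : nat -> C) (l : C) : Prop :=
  forall eps : R, 0 < eps ->
    exists M : nat, forall n : nat, (M <= n)%nat -> Cmod (csum u n - l) < eps.

Lemma csum_sum_n (u : nat -> C) (n : nat) :
  @sum_n C_AbelianGroup u n = csum u (S n).
Proof.
  induction n as [|n IH].
  - rewrite sum_O. simpl. now rewrite Cplus_0_l.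
  - rewrite sum_Sn, IH. reflexivity.
Qed.

Lemma is_series_csum_lim (u : nat -> C) (l : C) :
  @is_series C_AbsRing C_NormedModule u l <-> csum_lim u l.
Proof.
  assert (E := @filterlim_locally_ball_norm C_AbsRing nat C_NormedModule eventually _
                 (@sum_n C_AbelianGroup u) l).
  split.
  - intros H eps Heps. destruct (proj1 E H (mkposreal _ Heps)) as [M HM].
    exists (S M). intros n Hn. destruct n as [|n]; [lia|].
    specialize (HM n ltac:(lia)). unfold ball_norm in HM.
    rewrite <- csum_sum_n. exact HM.
  - intros H. apply (proj2 E). intros eps. destruct (H eps (cond_pos eps)) as [M HM].
    exists M. intros n Hn. unfold ball_norm.
    specialize (HM (S n) ltac:(lia)). rewrite <- csum_sum_n in HM. exact HM.
Qed.

Lemma pow_n_Cpow (z : C) (n : nat) : @pow_n C_Ring z n = (z ^ n)%C.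
Proof. induction n as [|n IH]; simpl; [reflexivity|]. now rewrite IH. Qed.

Lemma csum_lim_ext (u v : nat -> C) (l : C) :
  (forall n, u n = v n) -> csum_lim u l -> csum_lim v l.
Proof.
  intros E H eps Heps. destruct (H eps Heps) as [M HM]; exists M; intros n Hn.
  rewrite <- (csum_ext u v n E); auto.
Qed.

Lemma power_series_sum_iff (c : nat -> C) (z l : C) :
  power_series_sum c z l <-> csum_lim (fun n => c n * z ^ n)%C l.
Proof.
  unfold power_series_sum, is_pseries.
  assert (E : forall n, @scal C_Ring C_ModuleSpace (@pow_n C_Ring z n) (c n)
                        = (c n * z ^ n)%C).
  { intros n. rewrite pow_n_Cpow. apply Cmult_comm. }
  split; intros H.
  - apply is_series_csum_lim in H. revert H; now apply csum_lim_ext.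
  - apply is_series_csum_lim. revert H; apply csum_lim_ext. intros n; symmetry; apply E.
Qed.

Lemma csum_lim_lin (c : C) (u v : nat -> C) (l l' : C) :
  csum_lim u l -> csum_lim v l' -> csum_lim (fun n => u n + c * v n)%C (l + c * l').
Proof.
  intros H H' eps Heps.
  pose proof (Cmod_ge_0 c) as Hc.
  assert (He : 0 < eps / (Cmod c + 1)) by (apply Rdiv_lt_0_compat; lra).
  destruct (H _ He) as [M HM]. destruct (H' _ He) as [M' HM'].
  exists (M + M')%nat; intros n Hn.
  specialize (HM n ltac:(lia)). specialize (HM' n ltac:(lia)).
  rewrite csum_lin.
  replace (csum u n + c * csum v n - (l + c * l'))%C
    with ((csum u n - l) + c * (csum v n - l'))%C by ring.
  eapply Rle_lt_trans; [apply Cmod_triangle|]. rewrite Cmod_mult.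
  replace eps with (eps / (Cmod c + 1) + Cmod c * (eps / (Cmod c + 1))) by (field; lra).
  apply Rplus_lt_le_compat; [lra|]. apply Rmult_le_compat_l; lra.
Qed.

Lemma csum_lim_0 : csum_lim (fun _ => RtoC 0) 0.
Proof.
  intros eps Heps; exists O; intros n _. rewrite csum_const.
  replace (INR n * 0 - 0)%C with (RtoC 0) by ring. now rewrite Cmod_0.
Qed.

Lemma csum_lim_scal (c : C) (u : nat -> C) (l : C) :
  csum_lim u l -> csum_lim (fun n => c * u n)%C (c * l).
Proof.
  intros H. replace (c * l)%C with (0 + c * l)%C by ring.
  apply csum_lim_ext with (fun n => 0 + c * u n)%C; [intros; ring|].
  apply csum_lim_lin; [apply csum_lim_0|exact H].
Qed.

Lemma csum_lim_shift (u : nat -> C) (l : C) :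
  csum_lim (fun n => u (S n)) l <-> csum_lim u (u O + l).
Proof.
  split; intros H eps Heps; destruct (H eps Heps) as [M HM]; exists (S M); intros n Hn.
  - destruct n as [|n]; [lia|]. rewrite csum_S_l.
    replace (u O + csum (fun k => u (S k)) n - (u O + l))%C
      with (csum (fun k => u (S k)) n - l)%C by ring.
    apply HM; lia.
  - specialize (HM (S n) ltac:(lia)). rewrite csum_S_l in HM.
    now replace (u O + csum (fun k => u (S k)) n - (u O + l))%C
      with (csum (fun k => u (S k)) n - l)%C in HM by ring.
Qed.

Lemma csum_lim_Cmod_le (u : nat -> C) (l : C) (B : R) :
  csum_lim u l -> (forall n, Cmod (csum u n) <= B) -> Cmod l <= B.
Proof.
  intros H HB. apply Rnot_lt_le; intros Hlt.
  destruct (H (Cmod l - B) ltac:(lra)) as [M HM].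
  specialize (HM M (le_n _)). specialize (HB M).
  pose proof (Cmod_le_add_sub l (csum u M)) as H1.
  rewrite (Cmod_minus_sym l (csum u M)) in H1. lra.
Qed.

Lemma csum_lim_unique (u : nat -> C) (l l' : C) :
  csum_lim u l -> csum_lim u l' -> l = l'.
Proof.
  intros H H'. apply Ceq_minus, Cmod_eq_0, Rle_antisym; [|apply Cmod_ge_0].
  replace (l - l')%C with (l + (-(1)) * l')%C by ring.
  apply csum_lim_Cmod_le with (1 := csum_lim_lin (-(1)) _ _ _ _ H H').
  intros n. rewrite csum_lin. replace (csum u n + - (1) * csum u n)%C with (RtoC 0) by ring.
  rewrite Cmod_0; lra.
Qed.

Lemma csum_Cmod_psum (u : nat -> C) (n : nat) :
  Cmod (csum u n) <= psum (fun k => Cmod (u k)) n.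
Proof.
  induction n as [|n IH]; simpl; [rewrite Cmod_0; lra|].
  eapply Rle_trans; [apply Cmod_triangle|]. lra.
Qed.

Lemma sum_n_psum (x : nat -> R) (n : nat) : sum_n x n = psum x (S n).
Proof.
  induction n as [|n IH].
  - rewrite sum_O. simpl; ring.
  - rewrite sum_Sn, IH. reflexivity.
Qed.

Lemma ex_series_of_psum_le (x : nat -> R) (B : R) :
  (forall k, 0 <= x k) -> (forall n, psum x n <= B) -> ex_series x.
Proof.
  intros Hx HB. destruct (ex_finite_lim_seq_incr (sum_n x) B) as [l Hl].
  - intros n. rewrite sum_Sn. specialize (Hx (S n)). unfold plus; simpl; lra.
  - intros n. rewrite sum_n_psum. apply HB.
  - exists l. exact Hl.
Qed.

Lemma Series_le_of_psum_le (x : nat -> R) (B : R) :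
  (forall k, 0 <= x k) -> (forall n, psum x n <= B) -> Series x <= B.
Proof.
  intros Hx HB. pose proof (Series_correct _ (ex_series_of_psum_le x B Hx HB)) as H.
  apply (is_lim_seq_le (sum_n x) (fun _ => B) (Series x) B).
  - intros n. rewrite sum_n_psum. apply HB.
  - exact H.
  - apply is_lim_seq_const.
Qed.

Lemma psum_bounded_of_ex_series (x : nat -> R) :
  (forall k, 0 <= x k) -> ex_series x -> exists B, 0 <= B /\ forall n, psum x n <= B.
Proof.
  intros Hx [l Hl].
  assert (H : forall n, psum x (S n) <= l).
  { intros n. rewrite <- sum_n_psum. apply (is_lim_seq_incr_compare (sum_n x)).
    - exact Hl.
    - intros k. rewrite sum_Sn. specialize (Hx (S k)). unfold plus; simpl; lra. }
  assert (H0 : 0 <= l).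
  { pose proof (H O) as H1. simpl in H1. specialize (Hx O). lra. }
  exists l; split; [exact H0|]. intros [|n]; [exact H0|apply H].
Qed.

Lemma csum_lim_exists (u : nat -> C) (B : R) :
  (forall n, psum (fun k => Cmod (u k)) n <= B) -> exists l, csum_lim u l.
Proof.
  intros HB.
  destruct (@ex_series_le C_AbsRing C_CompleteNormedModule u (fun k => Cmod (u k)))
    as [l Hl].
  - intros n. apply Rle_refl.
  - apply ex_series_of_psum_le with B; [intros; apply Cmod_ge_0|exact HB].
  - exists l. now apply is_series_csum_lim.
Qed.

Lemma csum_lim_term_bounded (u : nat -> C) (l : C) :
  csum_lim u l -> exists B, forall n, Cmod (u n) <= B.
Proof.
  intros H. destruct (H 1 Rlt_0_1) as [M HM].
  assert (Hfin : forall N, exists B, 2 <= B /\ forall n, (n < N)%nat -> Cmod (u n) <= B).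
  { induction N as [|N [B [HB2 HB]]]; [exists 2; split; [lra|intros; lia]|].
    exists (Rmax B (Cmod (u N))); split; [eapply Rle_trans; [exact HB2|apply Rmax_l]|].
    intros n Hn. destruct (Nat.eq_dec n N) as [->|E]; [apply Rmax_r|].
    eapply Rle_trans; [apply HB; lia|apply Rmax_l]. }
  destruct (Hfin M) as (B & HB2 & HB). exists B. intros n.
  destruct (Nat.lt_ge_cases n M) as [Hn|Hn]; [auto|].
  replace (u n) with (csum u (S n) - csum u n)%C by (simpl; ring).
  pose proof (HM n Hn). pose proof (HM (S n) ltac:(lia)).
  pose proof (Cmod_triangle_sub (csum u (S n)) l (csum u n)) as H2.
  rewrite (Cmod_minus_sym l (csum u n)) in H2. lra.
Qed.

(** * Power series are strictly differentiable *)

Lemma CV_radius_ge (a : nat -> C) (rho : R) :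
  (forall t, 0 < t < rho -> exists B, forall n, Cmod (a n) * t ^ n <= B) ->
  Rbar_le rho (CV_radius (fun n => Cmod (a n))).
Proof.
  intros H. destruct (CV_radius_bounded (fun n => Cmod (a n))) as [Hub _].
  set (cv := CV_radius _) in *.
  assert (Hlt : forall t, 0 < t < rho -> Rbar_le t cv).
  { intros t Ht. apply Hub. destruct (H t Ht) as [B HB]. exists B. intros n.
    rewrite Rabs_right; [apply HB|].
    apply Rle_ge, Rmult_le_pos; [apply Cmod_ge_0|apply pow_le; lra]. }
  assert (Hcv0 : Rbar_le 0 cv).
  { apply Hub. exists (Cmod (a O)). intros n. destruct n as [|n].
    - simpl. rewrite Rmult_1_r, Rabs_right; [lra|apply Rle_ge, Cmod_ge_0].
    - rewrite pow_i by lia. rewrite Rmult_0_r, Rabs_R0. apply Cmod_ge_0. }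
  destruct cv as [c| |]; simpl in *; auto.
  apply Rnot_lt_le; intros Hc.
  assert (0 < (c + rho) / 2 < rho) by lra.
  specialize (Hlt _ H0). lra.
Qed.

(** The absolute coefficients form a real power series of radius at least [rho];
    its first two derivatives converge absolutely at [s]. *)
Lemma derived_coef_bounds (a : nat -> C) (rho s : R) :
  (forall t, 0 < t < rho -> exists B, forall n, Cmod (a n) * t ^ n <= B) ->
  0 <= s < rho ->
  (exists B, 0 <= B /\
     forall n, psum (fun k => INR (S k) * Cmod (a (S k)) * s ^ k) n <= B) /\
  (exists B, 0 <= B /\
     forall n, psum (fun k => INR (S k) * INR (S (S k)) * Cmod (a (S (S k))) * s ^ k) n <= B).
Proof.
  intros H Hs. pose proof (CV_radius_ge _ _ H) as Hcv.
  set (A := fun n => Cmod (a n)) in *.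
  assert (Hlt : Rbar_lt (Rabs s) (CV_radius A)).
  { rewrite Rabs_right by lra. apply Rbar_lt_le_trans with rho; [simpl; lra|exact Hcv]. }
  assert (Hex : forall x, CV_radius x = CV_radius A -> (forall k, 0 <= x k) ->
            exists B, 0 <= B /\ forall n, psum (fun k => x k * s ^ k) n <= B).
  { intros x Ex Hx.
    assert (Hnn : forall k, 0 <= x k * s ^ k)
      by (intros; apply Rmult_le_pos; [auto|apply pow_le; lra]).
    apply psum_bounded_of_ex_series; [exact Hnn|].
    rewrite <- Ex in Hlt. apply CV_disk_inside in Hlt. revert Hlt; apply ex_series_ext.
    intros n. rewrite Rabs_right; [reflexivity|]. apply Rle_ge, Hnn. }
  split.
  - apply (Hex (PS_derive A)); [apply CV_radius_derive|].
    intros k. apply Rmult_le_pos; [apply pos_INR|apply Cmod_ge_0].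
  - destruct (Hex (PS_derive (PS_derive A))) as (B & HB0 & HB).
    + now rewrite !CV_radius_derive.
    + intros k. apply Rmult_le_pos; [apply pos_INR|].
      apply Rmult_le_pos; [apply pos_INR|apply Cmod_ge_0].
    + exists B; split; [exact HB0|]. intros n. specialize (HB n).
      erewrite psum_ext; [exact HB|]. intros k. unfold PS_derive, A. ring.
Qed.

Lemma Cpow_sub_le (z z0 : C) (s d : R) (n : nat) :
  Cmod z <= s -> Cmod z0 <= s -> Cmod (z - z0) <= d ->
  Cmod (z ^ S n - z0 ^ S n) <= INR (S n) * s ^ n * d.
Proof.
  intros Hz Hz0 Hd. pose proof (Cmod_ge_0 z) as P1. pose proof (Cmod_ge_0 z0) as P2.
  pose proof (Cmod_ge_0 (z - z0)) as P3.
  induction n as [|n IH].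
  - simpl. replace (z * 1 - z0 * 1)%C with (z - z0)%C by ring. lra.
  - replace (z ^ S (S n) - z0 ^ S (S n))%C
      with (z * (z ^ S n - z0 ^ S n) + (z - z0) * z0 ^ S n)%C by (simpl; ring).
    eapply Rle_trans; [apply Cmod_triangle|]. rewrite !Cmod_mult, Cmod_pow.
    assert (H1 : Cmod z * Cmod (z ^ S n - z0 ^ S n) <= s * (INR (S n) * s ^ n * d))
      by (apply Rmult_le_compat; auto; apply Cmod_ge_0).
    assert (H2 : Cmod (z - z0) * Cmod z0 ^ S n <= d * s ^ S n).
    { apply Rmult_le_compat; auto; [apply pow_le; lra|apply pow_incr; lra]. }
    rewrite (S_INR (S n)). simpl pow in *. lra.
Qed.

(** [E (k+1) = w E k + (k+1) z0^k (w-z0)(w-z) + (w-z)(z^(k+1) - z0^(k+1))] for the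
    errors [E k = w^(k+1) - z^(k+1) - (k+1) z0^k (w-z)]. *)
Lemma Cpow_strict_diff (z w z0 : C) (s d : R) (n : nat) :
  0 < s -> Cmod z <= s -> Cmod w <= s -> Cmod z0 <= s ->
  Cmod (z - z0) <= d -> Cmod (w - z0) <= d ->
  Cmod (w ^ S (S n) - z ^ S (S n) - INR (S (S n)) * z0 ^ S n * (w - z))
    <= INR (S n) * INR (S (S n)) * s ^ n * d * Cmod (w - z).
Proof.
  intros Hs Hz Hw Hz0 Hd Hd'. set (D := Cmod (w - z)).
  assert (HD : 0 <= D) by apply Cmod_ge_0.
  assert (Hd0 : 0 <= d) by (eapply Rle_trans; [apply Cmod_ge_0|exact Hd]).
  set (E := fun k => (w ^ S k - z ^ S k - INR (S k) * z0 ^ k * (w - z))%C).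
  assert (Step : forall k, s * Cmod (E k) <= INR k * INR (S k) * s ^ k * d * D ->
            Cmod (E (S k)) <= INR (S k) * INR (S (S k)) * s ^ k * d * D).
  { intros k Hk. unfold E at 1.
    replace (w ^ S (S k) - z ^ S (S k) - INR (S (S k)) * z0 ^ S k * (w - z))%C
      with (w * E k + (INR (S k) * z0 ^ k * (w - z0) * (w - z)
              + (w - z) * (z ^ S k - z0 ^ S k)))%C
      by (unfold E; rewrite (S_INR (S k)), RtoC_plus; simpl Cpow; ring).
    eapply Rle_trans; [apply Cmod_triangle|].
    eapply Rle_trans; [apply Rplus_le_compat_l, Cmod_triangle|].
    rewrite !Cmod_mult, Cmod_pow, Cmod_R, (Rabs_right (INR (S k)))
      by apply Rle_ge, pos_INR. fold D.
    pose proof (Cpow_sub_le z z0 s d k Hz Hz0 Hd) as H1.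
    pose proof (pos_INR (S k)) as Hp.
    assert (T1 : Cmod w * Cmod (E k) <= s * Cmod (E k))
      by (apply Rmult_le_compat_r; [apply Cmod_ge_0|exact Hw]).
    assert (T2 : INR (S k) * Cmod z0 ^ k * Cmod (w - z0) * D <= INR (S k) * s ^ k * d * D).
    { apply Rmult_le_compat_r; [exact HD|]. apply Rmult_le_compat; auto using Cmod_ge_0.
      - apply Rmult_le_pos; [exact Hp|apply pow_le, Cmod_ge_0].
      - apply Rmult_le_compat_l; [exact Hp|]. apply pow_incr; split; auto using Cmod_ge_0. }
    assert (T3 : D * Cmod (z ^ S k - z0 ^ S k) <= D * (INR (S k) * s ^ k * d))
      by (apply Rmult_le_compat_l; auto).
    assert (Id : INR (S k) * INR (S (S k)) * s ^ k * d * D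
      = INR k * INR (S k) * s ^ k * d * D + INR (S k) * s ^ k * d * D
        + D * (INR (S k) * s ^ k * d)) by (rewrite !S_INR; ring).
    lra. }
  apply (Step n). induction n as [|n IH].
  - unfold E. simpl. replace (w * 1 - z * 1 - 1 * 1 * (w - z))%C with (RtoC 0) by ring.
    rewrite Cmod_0. lra.
  - apply Step in IH. apply Rle_trans with
      (s * (INR (S n) * INR (S (S n)) * s ^ n * d * D)).
    + apply Rmult_le_compat_l; lra.
    + simpl pow. lra.
Qed.

Definition derived (a : nat -> C) (n : nat) : C := INR (S n) * a (S n).

(** Termwise differentiation.  The bound of [Cpow_strict_diff], summed against
    the coefficients, is [d |w - z|] times a convergent series. *)
Lemma power_series_strict_derivative (a : nat -> C) (F : C -> C) (rho : R) (z0 : C) :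
  (forall z, Cmod z < rho -> power_series_sum a z (F z)) -> Cmod z0 < rho ->
  exists L, power_series_sum (derived a) z0 L /\ strict_derivative F z0 L.
Proof.
  intros HF Hz0. pose proof (Cmod_ge_0 z0) as Hz0p.
  assert (Hbd : forall t, 0 < t < rho -> exists B, forall n, Cmod (a n) * t ^ n <= B).
  { intros t Ht.
    assert (E : Cmod (RtoC t) = t) by (rewrite Cmod_R; apply Rabs_right; lra).
    destruct (csum_lim_term_bounded _ _
      (proj1 (power_series_sum_iff _ _ _) (HF (RtoC t) ltac:(lra)))) as [B HB].
    exists B. intros n. specialize (HB n).
    now rewrite Cmod_mult, Cmod_pow, E in HB. }
  destruct (derived_coef_bounds a rho (Cmod z0) Hbd ltac:(lra)) as [[B1 [_ HB1]] _].
  destruct (csum_lim_exists (fun n => derived a n * z0 ^ n)%C B1) as [L HL].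
  { intros n. erewrite psum_ext; [apply (HB1 n)|]. intros k. unfold derived.
    rewrite !Cmod_mult, Cmod_pow, Cmod_R, Rabs_right by apply Rle_ge, pos_INR.
    reflexivity. }
  exists L; split; [now apply power_series_sum_iff|].
  set (s := (Cmod z0 + rho) / 2).
  destruct (derived_coef_bounds a rho s Hbd) as [_ [B [HB0 HB]]]; [unfold s; lra|].
  intros eps Heps.
  set (d := Rmin ((rho - Cmod z0) / 2) (eps / (B + 1))).
  assert (Hd : 0 < d) by (apply Rmin_pos; [lra|apply Rdiv_lt_0_compat; lra]).
  assert (Hd1 : d <= (rho - Cmod z0) / 2) by apply Rmin_l.
  assert (Hd2 : d * B <= eps).
  { apply Rle_trans with (eps / (B + 1) * (B + 1)).
    - apply Rmult_le_compat; try lra. apply Rmin_r.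
    - right; field; lra. }
  exists d; split; [exact Hd|]. intros z w Hz Hw.
  assert (Hzs : Cmod z <= s).
  { pose proof (Cmod_le_add_sub z z0). unfold s; lra. }
  assert (Hws : Cmod w <= s).
  { pose proof (Cmod_le_add_sub w z0). unfold s; lra. }
  assert (Hsr : s < rho) by (unfold s; lra).
  (* termwise: F w - F z - L (w - z) = sum a_n (w^n - z^n - n z0^(n-1) (w - z)) *)
  set (v := fun n => match n with O => RtoC 0 | S k => (derived a k * z0 ^ k)%C end).
  assert (Hv : csum_lim v L).
  { replace L with (v O + L)%C by (simpl; ring). now apply csum_lim_shift. }
  pose proof (proj1 (power_series_sum_iff _ _ _) (HF z ltac:(lra))) as Sz.
  pose proof (proj1 (power_series_sum_iff _ _ _) (HF w ltac:(lra))) as Sw.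
  pose proof (csum_lim_lin (-(1)) _ _ _ _
    (csum_lim_lin (-(1)) _ _ _ _ Sw Sz) (csum_lim_scal (w - z) _ _ Hv)) as HS.
  replace (F w - F z - L * (w - z))%C
    with (F w + - (1) * F z + - (1) * ((w - z) * L))%C by ring.
  set (u := fun n : nat => (a n * w ^ n + - (1) * (a n * z ^ n) + - (1) * ((w - z) * v n))%C) in HS.
  assert (HD : 0 <= d * Cmod (w - z)) by (apply Rmult_le_pos; [lra|apply Cmod_ge_0]).
  apply Rle_trans with (d * Cmod (w - z) * B).
  2:{ replace (d * Cmod (w - z) * B) with (d * B * Cmod (w - z)) by ring.
      apply Rmult_le_compat_r; [apply Cmod_ge_0|exact Hd2]. }
  apply csum_lim_Cmod_le with u; [exact HS|].
  assert (U0 : u O = 0) by (unfold u, v; simpl; ring).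
  assert (U1 : u 1%nat = 0) by (unfold u, v, derived; simpl; ring).
  assert (HdB : 0 <= d * Cmod (w - z) * B) by (apply Rmult_le_pos; lra).
  intros [|[|n]]; [simpl; now rewrite Cmod_0|simpl; rewrite U0, Cplus_0_l; now rewrite Cmod_0|].
  rewrite !csum_S_l, U0, U1, !Cplus_0_l.
  eapply Rle_trans; [apply csum_Cmod_psum|].
  eapply Rle_trans; [|apply Rmult_le_compat_l; [exact HD|apply (HB n)]].
  rewrite <- psum_scal. apply psum_le; intros k _.
  replace (u (S (S k))) with (a (S (S k)) *
    (w ^ S (S k) - z ^ S (S k) - INR (S (S k)) * z0 ^ S k * (w - z)))%C
    by (unfold u, v, derived; ring).
  rewrite Cmod_mult.
  pose proof (Cpow_strict_diff z w z0 s d k ltac:(unfold s; lra) Hzs Hws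
    ltac:(unfold s; lra) ltac:(lra) ltac:(lra)) as HE.
  pose proof (Cmod_ge_0 (a (S (S k)))) as Ha.
  eapply Rle_trans; [apply Rmult_le_compat_l; [exact Ha|exact HE]|]. right; ring.
Qed.

Lemma strict_derivative_C_derive (F : C -> C) (z0 L : C) :
  strict_derivative F z0 L -> C_derive F z0 = L.
Proof.
  intros H. apply is_C_lim_unique.
  apply filterlim_locally. intros eps.
  assert (He : 0 < eps / 2) by (pose proof (cond_pos eps); lra).
  destruct (H _ He) as (d & Hd & HF).
  assert (Hd2 : 0 < d / 2) by lra.
  exists (mkposreal _ Hd2). intros w Hw Hne.
  assert (Hwd : Cmod (w - z0) < d).
  { pose proof (Cmod_le_coords (w - z0)) as Hc. destruct Hw as [H1 H2].
    change (Rabs (Re (w - z0)) < d / 2) in H1. change (Rabs (Im (w - z0)) < d / 2) in H2.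
    lra. }
  assert (Hz0 : Cmod (z0 - z0) < d) by (rewrite Cmod_self; lra).
  specialize (HF _ _ Hz0 Hwd).
  assert (Hn : (w - z0)%C <> 0) by (intros E; apply Hne, Ceq_minus, E).
  assert (Hm : 0 < Cmod (w - z0)) by now apply Cmod_gt_0.
  assert (HQ : Cmod ((F w - F z0) / (w - z0) - L) < eps).
  { replace ((F w - F z0) / (w - z0) - L)%C
      with ((F w - F z0 - L * (w - z0)) / (w - z0))%C by (field; exact Hn).
    rewrite Cmod_div by exact Hn. apply Rle_lt_trans with (eps / 2); [|lra].
    apply Rle_div_l; lra. }
  pose proof (re_le_Cmod ((F w - F z0) / (w - z0) - L)) as R1.
  pose proof (im_le_Cmod ((F w - F z0) / (w - z0) - L)) as R2.
  set (q := ((F w - F z0) / (w - z0))%C) in *.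
  split.
  - change (Rabs (Re (q - L)) < eps). lra.
  - change (Rabs (Im (q - L)) < eps). lra.
Qed.

Lemma analytic_at_strict_derivative (F : C -> C) (z0 : C) :
  analytic_at F z0 -> exists L, strict_derivative F z0 L.
Proof.
  intros (c & rho & HF).
  destruct (power_series_strict_derivative c (fun u => F (u + z0)%C) rho 0) as (L & _ & HL).
  - intros z Hz. replace z with (z + z0 - z0)%C at 1 by ring. apply HF.
    now replace (z + z0 - z0)%C with z by ring.
  - rewrite Cmod_0. apply cond_pos.
  - exists (L * (1 + 0))%C.
    apply strict_derivative_ext with (fun z => F (z + - z0 + z0)%C).
    + exists 1; split; [lra|]. intros z w _ _. split; f_equal; ring.
    + apply (strict_derivative_comp (fun u => F (u + z0)%C) (fun z => z + - z0)%C).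
      * apply strict_derivative_plus; [apply strict_derivative_id|apply strict_derivative_const].
      * now replace (z0 + - z0)%C with (RtoC 0) by ring.
Qed.

Lemma analytic_holomorphic (F : C -> C) : analytic F -> holomorphic F.
Proof. intros H z Hz. apply analytic_at_strict_derivative; auto. Qed.

Lemma power_series_at_0 (c : nat -> C) (l : C) : power_series_sum c 0 l -> l = c O.
Proof.
  intros H. apply power_series_sum_iff in H.
  apply (csum_lim_unique _ _ _ H).
  replace (c O) with (c O * 0 ^ 0 + 0)%C by (simpl; ring).
  apply (csum_lim_shift (fun n => c n * 0 ^ n)%C).
  apply csum_lim_ext with (fun _ => RtoC 0); [intros; rewrite Cpow_S; ring|].
  apply csum_lim_0.
Qed.

(** Removing the constant term and dividing by [z] shifts the series near [0] and
    is harmless away from [0], so both hypotheses pass on to the quotient. *)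
Lemma taylor_of_power_series (N : nat) (c : nat -> C) (F : C -> C) (rho : R) :
  holomorphic F -> 0 < rho ->
  (forall z, Cmod z < rho -> power_series_sum c z (F z)) -> taylor N c F.
Proof.
  intros HF Hrho. revert c F HF; induction N as [|N IH]; intros c F HF HS; [exact HF|].
  assert (D0 : Cmod 0 < rho) by (rewrite Cmod_0; exact Hrho).
  pose proof (power_series_at_0 _ _ (HS 0 D0)) as HF0.
  set (K := fun z : C => if excluded_middle_informative (z = 0) then c 1%nat
                         else ((F z + - c O) * / z)%C).
  assert (HK0 : K 0 = c 1%nat).
  { unfold K. destruct (excluded_middle_informative _); [reflexivity|congruence]. }
  assert (HK : forall z : C, z <> 0 -> K z = ((F z + - c O) * / z)%C).
  { intros z Hz. unfold K. destruct (excluded_middle_informative _); [contradiction|reflexivity]. }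
  assert (HKS : forall z, Cmod z < rho -> power_series_sum (fun k => c (S k)) z (K z)).
  { intros z Hz. apply power_series_sum_iff. destruct (classic (z = 0)) as [->|Hn].
    - rewrite HK0. replace (c 1%nat) with (c 1%nat * 0 ^ 0 + 0)%C by (simpl; ring).
      apply (csum_lim_shift (fun n => c (S n) * 0 ^ n)%C).
      apply csum_lim_ext with (fun _ => RtoC 0); [intros; rewrite Cpow_S; ring|].
      apply csum_lim_0.
    - rewrite HK by exact Hn. pose proof (proj1 (power_series_sum_iff _ _ _) (HS z Hz)) as H.
      replace (F z) with (c O * z ^ 0 + (F z + - c O))%C in H by (simpl; ring).
      apply (csum_lim_shift (fun n => c n * z ^ n)%C) in H.
      apply (csum_lim_scal (/ z)) in H.
      replace ((F z + - c O) * / z)%C with (/ z * (F z + - c O))%C by ring.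
      revert H; apply csum_lim_ext. intros n. rewrite Cpow_S. field. exact Hn. }
  exists K; split.
  - intros z Hz. destruct (classic (z = 0)) as [->|Hn].
    + rewrite HF0. ring.
    + rewrite HK by exact Hn. field. exact Hn.
  - apply IH; [|exact HKS]. intros z Hz. destruct (classic (z = 0)) as [->|Hn].
    + destruct (power_series_strict_derivative _ K rho 0 HKS D0) as (L & _ & HL).
      now exists L.
    + destruct (HF z Hz) as [L HL].
      eexists. apply strict_derivative_ext with (fun u => (F u + - c O) * / u)%C.
      * apply Cmod_gt_0 in Hn as Hm. exists (Cmod z); split; [exact Hm|].
        assert (Hnz : forall u, Cmod (u - z) < Cmod z -> u <> 0).
        { intros u Hu ->. rewrite Cmod_minus_sym in Hu.
          replace (z - 0)%C with z in Hu by ring. lra. }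
        intros u w Hu Hw. rewrite !HK by auto. auto.
      * apply strict_derivative_mult; [|now apply strict_derivative_inv].
        apply strict_derivative_plus; [exact HL|apply strict_derivative_const].
Qed.

Lemma analytic_taylor (N : nat) (F : C -> C) :
  analytic F -> exists c, taylor N c F.
Proof.
  intros H. assert (D0 : disk 0) by (unfold disk; rewrite Cmod_0; lra).
  destruct (H 0 D0) as (c & rho & HS). exists c.
  apply taylor_of_power_series with rho; [now apply analytic_holomorphic|apply cond_pos|].
  intros z Hz. replace z with (z - 0)%C at 1 by ring. apply HS.
  now replace (z - 0)%C with z by ring.
Qed.


(** * The Schwarz lemma *)

Lemma mean_lim_Cmod_le (v : C -> C) (l : C) (B : R) :
  (forall zeta, Cmod zeta = 1 -> Cmod (v zeta) <= B) -> mean_lim v l -> Cmod l <= B.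
Proof.
  intros Hv H. destruct (unit_rotation l) as (alpha & Ha & Hal).
  pose proof (mean_lim_scal alpha _ _ H) as H1. rewrite Hal in H1.
  pose proof (fun K => mean_lim_re_le _ _ _ _ K H1 (mean_lim_const B)) as Hle.
  rewrite !re_RtoC in Hle. apply Hle. intros zeta Hz. specialize (Hv zeta Hz).
  pose proof (re_le_Cmod (alpha * v zeta)) as Hre.
  rewrite Cmod_mult, Ha in Hre. apply Rabs_le_between in Hre. lra.
Qed.

Definition mobius (a z : C) : C := ((z + a) * / (1 + Cconj a * z))%C.

Lemma mobius_identity (a z : C) :
  Cmod (1 + Cconj a * z) ^ 2 - Cmod (z + a) ^ 2
  = (1 - Cmod a ^ 2) * (1 - Cmod z ^ 2).
Proof.
  rewrite !Cmod2_alt. destruct a as [x y], z as [s t].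
  unfold Re, Im, Cconj, Cplus, Cmult, RtoC; simpl; ring.
Qed.

Lemma mobius_denominator (a z : C) : disk a -> disk z ->
  1 - Cmod a <= Cmod (1 + Cconj a * z).
Proof.
  unfold disk; intros Ha Hz.
  pose proof (Cmod_le_add_sub 1 (- (Cconj a * z))) as H.
  rewrite Cmod_opp, Cmod_mult, Cmod_conj, Cmod_1 in H.
  replace (1 - - (Cconj a * z))%C with (1 + Cconj a * z)%C in H by ring.
  pose proof (Cmod_ge_0 a). pose proof (Cmod_ge_0 z).
  assert (Cmod a * Cmod z <= Cmod a * 1) by (apply Rmult_le_compat_l; lra). lra.
Qed.

Lemma mobius_denominator_neq_0 (a z : C) : disk a -> disk z -> (1 + Cconj a * z)%C <> 0.
Proof.
  intros Ha Hz. pose proof (mobius_denominator a z Ha Hz) as H.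
  apply Cmod_gt_0. unfold disk in Ha. lra.
Qed.

Lemma Cmod_mobius_sqr (a z : C) : disk a -> disk z ->
  1 - Cmod (mobius a z) ^ 2
  = (1 - Cmod a ^ 2) * (1 - Cmod z ^ 2) / Cmod (1 + Cconj a * z) ^ 2.
Proof.
  intros Ha Hz. pose proof (mobius_denominator_neq_0 a z Ha Hz) as Hn.
  unfold mobius. rewrite Cmod_mult, Cmod_inv by exact Hn.
  rewrite <- mobius_identity. apply Cmod_gt_0 in Hn. field. lra.
Qed.

Lemma sqr_lt_1 (x : R) : 0 <= x < 1 -> 0 < 1 - x ^ 2.
Proof. intros; nra. Qed.

Lemma mobius_disk (a z : C) : disk a -> disk z -> disk (mobius a z).
Proof.
  intros Ha Hz. pose proof (Cmod_mobius_sqr a z Ha Hz) as H.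
  pose proof (mobius_denominator a z Ha Hz) as Hd. unfold disk in *.
  pose proof (Cmod_ge_0 a). pose proof (Cmod_ge_0 z). pose proof (Cmod_ge_0 (mobius a z)).
  assert (Hp : 0 < 1 - Cmod (mobius a z) ^ 2).
  { rewrite H. apply Rdiv_lt_0_compat; [|apply pow_lt; lra].
    apply Rmult_lt_0_compat; apply sqr_lt_1; lra. }
  nra.
Qed.

Lemma holomorphic_mobius (a : C) : disk a -> holomorphic (mobius a).
Proof.
  intros Ha. apply (holomorphic_mult (fun z => z + a)%C (fun z => / (1 + Cconj a * z))%C).
  - apply holomorphic_plus; [apply holomorphic_id|apply holomorphic_const].
  - apply holomorphic_inv; [|intros; now apply mobius_denominator_neq_0].
    apply holomorphic_plus; [apply holomorphic_const|].
    apply (holomorphic_mult (fun _ => Cconj a)); [apply holomorphic_const|apply holomorphic_id].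
Qed.

(** The quotient [K = W/z] is holomorphic.  Its square, composed with the Moebius map
    that sends [0] to [a], has mean value [K a ^ 2] over the circle of radius [r];
    on that circle [|K|^2 <= 1/|mobius a|^2], which tends to 1 with [r]. *)
Lemma schwarz (w : nat -> C) (W : C -> C) :
  taylor 1 w W -> w O = 0 -> (forall z, disk z -> Cmod (W z) <= 1) ->
  forall z, disk z -> Cmod (W z) <= Cmod z.
Proof.
  intros (K & HK & HKh) Hw HW a Ha. simpl in HKh.
  assert (HWK : forall z, disk z -> Cmod z * Cmod (K z) <= 1).
  { intros z Hz. specialize (HW z Hz). rewrite HK, Hw, Cplus_0_l, Cmod_mult in HW by exact Hz.
    exact HW. }
  rewrite HK, Hw, Cplus_0_l, Cmod_mult by exact Ha.
  enough (Hk : Cmod (K a) <= 1).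
  { rewrite <- (Rmult_1_r (Cmod a)) at 2. apply Rmult_le_compat_l; [apply Cmod_ge_0|exact Hk]. }
  unfold disk in Ha. pose proof (Cmod_ge_0 a) as Ha0.
  set (M := (1 - Cmod a ^ 2) / (1 - Cmod a) ^ 2).
  assert (HM : 0 < M).
  { apply Rdiv_lt_0_compat; [apply sqr_lt_1; lra|apply pow_lt; lra]. }
  assert (Key : forall r, 0 < r < 1 -> 0 < 1 - M * (1 - r ^ 2) ->
            Cmod (K a) ^ 2 * (1 - M * (1 - r ^ 2)) <= 1).
  { intros r Hr Hrho. set (rho := 1 - M * (1 - r ^ 2)) in *.
    set (Q := fun z => (K (mobius a z) * K (mobius a z))%C).
    assert (HQ : holomorphic Q).
    { assert (holomorphic (fun z => K (mobius a z))).
      { apply holomorphic_comp; [exact HKh|now apply holomorphic_mobius|].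
        intros; now apply mobius_disk. }
      now apply holomorphic_mult. }
    pose proof (holomorphic_mean_value Q r HQ Hr) as Hmean.
    assert (Hm0 : mobius a 0 = a) by (unfold mobius; field; intros E;
      apply (f_equal Re) in E; simpl in E; lra).
    assert (HB : Cmod (Q 0) <= / rho).
    { apply mean_lim_Cmod_le with (2 := Hmean). intros zeta Hz.
      pose proof (disk_scal r zeta Hr Hz) as Hdz.
      pose proof (mobius_disk a _ Ha Hdz) as Hmd.
      pose proof (Cmod_mobius_sqr a _ Ha Hdz) as Hsq.
      pose proof (mobius_denominator a _ Ha Hdz) as Hden.
      assert (Hrz : Cmod (r * zeta) = r) by (rewrite Cmod_mult, Cmod_R, Hz, Rabs_right; lra).
      rewrite Hrz in Hsq.
      assert (Hlow : rho <= Cmod (mobius a (r * zeta)) ^ 2).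
      { enough ((1 - Cmod a ^ 2) * (1 - r ^ 2) / Cmod (1 + Cconj a * (r * zeta)) ^ 2
                <= M * (1 - r ^ 2)) by (unfold rho; lra).
        unfold M, Rdiv. rewrite (Rmult_comm _ (1 - r ^ 2)), Rmult_assoc,
          (Rmult_comm _ (1 - r ^ 2)).
        pose proof (sqr_lt_1 r ltac:(lra)). pose proof (sqr_lt_1 (Cmod a) ltac:(lra)).
        apply Rmult_le_compat_l; [lra|]. apply Rmult_le_compat_l; [lra|].
        apply Rinv_le_contravar; [apply pow_lt; lra|]. apply pow_incr; lra. }
      specialize (HWK _ Hmd). set (y := mobius a (r * zeta)) in *.
      unfold Q. fold y. rewrite Cmod_mult.
      pose proof (Cmod_ge_0 y). pose proof (Cmod_ge_0 (K y)).
      apply Rmult_le_reg_l with rho; [exact Hrho|]. rewrite Rinv_r by lra.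
      apply Rle_trans with (Cmod y ^ 2 * (Cmod (K y) * Cmod (K y))).
      - apply Rmult_le_compat_r; [apply Rmult_le_pos; lra|exact Hlow].
      - replace (Cmod y ^ 2 * (Cmod (K y) * Cmod (K y)))
          with ((Cmod y * Cmod (K y)) ^ 2) by ring.
        replace 1 with (1 ^ 2) by ring. apply pow_incr; split; [apply Rmult_le_pos; lra|lra]. }
    unfold Q in HB. rewrite Hm0, Cmod_mult in HB.
    apply Rmult_le_compat_r with (r := rho) in HB; [|lra]. rewrite Rinv_l in HB by lra.
    lra. }
  (* let r tend to 1, so that M (1 - r^2) tends to 0 *)
  apply Rnot_lt_le; intros Hlt. set (k := Cmod (K a)) in *.
  set (e := 1 - / k ^ 2).
  assert (Hk2 : 1 < k ^ 2) by nra.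
  assert (Hinv : 0 < / k ^ 2 < 1).
  { split; [apply Rinv_0_lt_compat; lra|]. rewrite <- Rinv_1.
    apply Rinv_lt_contravar; lra. }
  set (t := e / (4 * M + 2)).
  assert (He : 0 < e < 1) by (unfold e; lra).
  assert (Ht : 0 < t) by (apply Rdiv_lt_0_compat; lra).
  assert (Htt : t * (4 * M + 2) = e) by (unfold t; field; lra).
  assert (HtM : 0 < t * M) by now apply Rmult_lt_0_compat.
  assert (Ht1 : t < 1) by lra.
  assert (Hr2 : 1 - (1 - t) ^ 2 <= 2 * t) by nra.
  assert (Hr3 : M * (1 - (1 - t) ^ 2) <= e / 2).
  { apply Rle_trans with (M * (2 * t)); [apply Rmult_le_compat_l; lra|lra]. }
  specialize (Key (1 - t) ltac:(lra) ltac:(lra)).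
  assert (H1 : k ^ 2 * (1 - e / 2) <= 1).
  { eapply Rle_trans; [|exact Key]. apply Rmult_le_compat_l; lra. }
  assert (H2 : k ^ 2 * / k ^ 2 = 1) by (apply Rinv_r; lra).
  unfold e in H1. lra.
Qed.

(** * Half-planes containing a convex set *)

(** In the affine coordinate [X] with [X p = 0] and [X q = 1], the convex set
    avoids the nonpositive real axis.  Hence every point above the real axis has
    a larger ratio [Re X / Im X] than every point below it, and the line through
    the origin whose ratio is the supremum of the latter separates. *)
Lemma convex_separation (S : C -> Prop) (p : C) :
  convex_set S -> ~ S p ->
  exists u : C, Cmod u = 1 /\ forall w, S w -> Re (u * (w - p)) <= 0.
Proof.
  intros HS Hp.
  destruct (classic (exists q, S q)) as [[q Hq]|Hno].
  2:{ exists 1; split; [apply Cmod_1|]. intros w Hw; exfalso; eauto. }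
  assert (Hqp : (q - p)%C <> 0).
  { intros E. apply Ceq_minus in E. now subst. }
  set (X := fun w => ((w - p) / (q - p))%C).
  assert (Xcomb : forall w v (t : R), X ((1 - t)%R * w + t * v)%C = ((1 - t)%R * X w + t * X v)%C).
  { intros w v t. unfold X. rewrite RtoC_minus. field. exact Hqp. }
  assert (X0 : forall w, S w -> X w <> 0).
  { intros w Hw E. assert (E' : (w - p)%C = 0).
    { replace (w - p)%C with (X w * (q - p))%C by (unfold X; field; exact Hqp).
      rewrite E; ring. }
    apply Ceq_minus in E'. now subst. }
  assert (Xq : X q = 1) by (unfold X; field; exact Hqp).
  assert (Xreal : forall w, S w -> Im (X w) = 0 -> 0 < Re (X w)).
  { intros w Hw HI. apply Rnot_le_lt; intros HR.
    set (x := Re (X w)) in *. set (t := - x / (1 - x)).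
    assert (Ht : 0 <= t <= 1).
    { split; [apply Rdiv_le_0_compat; lra|]. apply Rle_div_l; lra. }
    apply (X0 _ (HS w q t Hw Hq Ht)). rewrite Xcomb, Xq.
    replace (X w) with (RtoC x).
    - rewrite <- !RtoC_mult, <- RtoC_plus. f_equal. unfold t. field. lra.
    - apply injective_projections; [reflexivity|symmetry; exact HI]. }
  assert (Xcross : forall w1 w2, S w1 -> S w2 -> 0 < Im (X w1) -> Im (X w2) < 0 ->
            0 < - Im (X w2) * Re (X w1) + Im (X w1) * Re (X w2)).
  { intros w1 w2 H1 H2 I1 I2. set (y1 := Im (X w1)) in *. set (y2 := Im (X w2)) in *.
    set (t := y1 / (y1 - y2)).
    assert (Ht : 0 <= t <= 1).
    { split; [apply Rdiv_le_0_compat; lra|]. apply Rle_div_l; lra. }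
    pose proof (Xreal _ (HS w1 w2 t H1 H2 Ht)) as H. rewrite Xcomb in H.
    assert (Ere : Re ((1 - t)%R * X w1 + t * X w2)%C
                  = (- y2 * Re (X w1) + y1 * Re (X w2)) / (y1 - y2)).
    { change (Re ((1 - t)%R * X w1 + t * X w2)%C)
        with (Re ((1 - t)%R * X w1)%C + Re (t * X w2)%C).
      rewrite !re_scal_l. unfold t. field. lra. }
    assert (Eim : Im ((1 - t)%R * X w1 + t * X w2)%C = 0).
    { change (Im ((1 - t)%R * X w1 + t * X w2)%C)
        with (Im ((1 - t)%R * X w1)%C + Im (t * X w2)%C).
      rewrite !im_scal_l. fold y1 y2. unfold t. field. lra. }
    specialize (H Eim). rewrite Ere in H.
    apply Rmult_lt_compat_r with (r := y1 - y2) in H; [|lra].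
    rewrite Rmult_0_l in H. unfold Rdiv in H. rewrite Rmult_assoc, Rinv_l in H by lra. lra. }
  assert (Hfun : exists al be : R, (al <> 0 \/ be <> 0) /\
            forall w, S w -> 0 <= al * Re (X w) + be * Im (X w)).
  { destruct (classic (exists w, S w /\ Im (X w) < 0)) as [[w2 [Sw2 I2]]|Hlow].
    2:{ exists 0, 1; split; [right; lra|]. intros w Hw. apply Rnot_lt_le; intros Hlt.
        apply Hlow; exists w; split; [exact Hw|lra]. }
    destruct (classic (exists w, S w /\ 0 < Im (X w))) as [[w1 [Sw1 I1]]|Hup].
    2:{ exists 0, (-1); split; [right; lra|]. intros w Hw. apply Rnot_lt_le; intros Hlt.
        apply Hup; exists w; split; [exact Hw|lra]. }
    set (E := fun m => exists w, S w /\ Im (X w) < 0 /\ m = Re (X w) / Im (X w)).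
    assert (Hub : forall w, S w -> 0 < Im (X w) -> is_upper_bound E (Re (X w) / Im (X w))).
    { intros w Hw Hi m (v & Hv & Hvi & ->). pose proof (Xcross w v Hw Hv Hi Hvi) as H.
      apply (proj1 (Rle_div_r _ _ _ Hi)).
      apply Rmult_le_reg_l with (- Im (X v)); [lra|].
      replace (- Im (X v) * (Re (X v) / Im (X v) * Im (X w)))
        with (- (Im (X w) * Re (X v))) by (field; lra). lra. }
    destruct (completeness E) as [m [Hm1 Hm2]].
    - exists (Re (X w1) / Im (X w1)). now apply Hub.
    - exists (Re (X w2) / Im (X w2)), w2. auto.
    - exists 1, (- m); split; [left; lra|]. intros w Hw.
      destruct (Rtotal_order (Im (X w)) 0) as [Hi|[Hi|Hi]].
      + assert (Hle : Re (X w) / Im (X w) <= m) by (apply Hm1; exists w; auto).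
        assert (Re (X w) = Re (X w) / Im (X w) * Im (X w)) by (field; lra).
        nra.
      + pose proof (Xreal w Hw Hi). rewrite Hi. lra.
      + pose proof (Hm2 _ (Hub w Hw Hi)) as Hle. apply (proj2 (Rle_div_r _ _ _ Hi)) in Hle. lra. }
  destruct Hfun as (al & be & Hne & Hfun).
  (* [al Re X + be Im X] is the real part of [(al - i be) X] *)
  set (v := (- (al, - be)%R / (q - p))%C : C).
  assert (Hv : v <> 0).
  { intros Ev. assert (E : (- (al, - be)%R)%C = 0).
    { replace (- (al, - be)%R)%C with (v * (q - p))%C by (unfold v; field; exact Hqp).
      rewrite Ev; ring. }
    unfold Copp, RtoC in E. injection E as E1 E2. simpl in E1, E2. lra. }
  apply Cmod_gt_0 in Hv as Hm.
  exists ((/ Cmod v)%R * v)%C; split.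
  - rewrite Cmod_mult, Cmod_R, Rabs_right by (apply Rle_ge, Rlt_le, Rinv_0_lt_compat, Hm).
    apply Rinv_l; lra.
  - intros w Hw. rewrite <- Cmult_assoc, re_scal_l.
    assert (Ev : (v * (w - p))%C = (- ((al, - be)%R * X w))%C)
      by (unfold v, X; field; exact Hqp).
    rewrite Ev. specialize (Hfun w Hw).
    assert (Er : Re (- ((al, - be)%R * X w))%C = - (al * Re (X w) + be * Im (X w)))
      by (unfold Re, Im; simpl; ring).
    rewrite Er. pose proof (Rinv_0_lt_compat _ Hm). nra.
Qed.

(** Near a boundary point that almost realizes the distance there is a point
    outside the set; a line through that point leaves the set on one side.  Both
    approximations are paid for by [eps]. *)
Lemma convex_half_plane (S : C -> Prop) (c : C) (lambda eps : R) :
  convex_set S -> dist_to c (boundary S) = Finite lambda -> 0 < eps ->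
  exists u : C, Cmod u = 1 /\ forall w, S w -> Re (u * (w - c)) <= lambda + eps.
Proof.
  intros HS Hd Heps.
  destruct (Glb_Rbar_correct (fun d => exists w, boundary S w /\ d = Cmod (c - w)))
    as [_ Hglb].
  change (Glb_Rbar _) with (dist_to c (boundary S)) in Hglb. rewrite Hd in Hglb.
  destruct (classic (exists w, boundary S w /\ Cmod (c - w) < lambda + eps / 2))
    as [[w0 [Hb Hw0]]|Hno].
  2:{ exfalso. assert (H : Rbar_le (lambda + eps / 2) lambda).
      { apply Hglb. intros d (w & Hw & ->). simpl. apply Rnot_lt_le; intros Hlt.
        apply Hno; eauto. }
      simpl in H. lra. }
  assert (He2 : 0 < eps / 2) by lra.
  destruct (Hb (mkposreal _ He2)) as [_ [z [Hz Hnz]]]. simpl in Hz.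
  destruct (convex_separation S z HS Hnz) as (u & Hu & Hsep).
  exists u; split; [exact Hu|]. intros w Hw. specialize (Hsep w Hw).
  assert (E : Re (u * (w - c))%C = Re (u * (w - z))%C + Re (u * (z - c))%C)
    by (unfold Re; simpl; ring).
  pose proof (re_le_Cmod (u * (z - c))) as H. rewrite Cmod_mult, Hu in H.
  apply Rabs_le_between in H.
  pose proof (Cmod_triangle_sub z w0 c) as H1. rewrite (Cmod_minus_sym w0 c) in H1.
  lra.
Qed.

Lemma dist_to_ge_0 (c : C) (S : C -> Prop) (lambda : R) :
  dist_to c S = Finite lambda -> 0 <= lambda.
Proof.
  intros Hd.
  destruct (Glb_Rbar_correct (fun d => exists w, S w /\ d = Cmod (c - w))) as [_ H].
  change (Glb_Rbar _) with (dist_to c S) in H. rewrite Hd in H.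
  apply (H (Finite 0)). intros d (w & _ & ->). apply Cmod_ge_0.
Qed.


Lemma disk_0 : disk 0.
Proof. unfold disk; rewrite Cmod_0; lra. Qed.

Lemma taylor_value_0 (N : nat) (c : nat -> C) (F : C -> C) :
  taylor (S N) c F -> F 0 = c O.
Proof. intros (K & HK & _). rewrite HK by exact disk_0. ring. Qed.

(** * Coefficient bounds for [h] and [g] *)

(** [lambda + eps/2 - u (phi o w - phi 0)] has nonnegative real part and value
    [lambda + eps/2] at [0]. *)
Lemma subordinate_coef_bound (N : nat) (phi w : C -> C) (lambda : R) :
  convex_univalent phi -> class_B0 w ->
  dist_to (phi 0) (boundary (disk_image phi)) = Finite lambda ->
  exists d : nat -> C, d O = 0 /\ taylor (S N) d (fun z => phi (w z) - phi 0)%C /\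
    forall n, (0 < n < S N)%nat -> Cmod (d n) <= 2 * lambda.
Proof.
  intros (Hphi & _ & Hconv) [[Hw Hw1] Hw0] Hdist.
  destruct (analytic_taylor (S N) phi Hphi) as [c Hc].
  destruct (analytic_taylor (S N) w Hw) as [e He].
  assert (He0 : e O = 0) by (now rewrite <- (taylor_value_0 _ _ _ He)).
  assert (Hdisk : forall z, disk z -> disk (w z)).
  { intros z Hz. assert (He1 : taylor 1 e w).
    { destruct He as (K & HK & HT). exists K; split; [exact HK|].
      exact (taylor_holomorphic _ _ _ HT). }
    pose proof (schwarz e w He1 He0 Hw1 z Hz). unfold disk in *. lra. }
  destruct (taylor_comp _ _ _ _ _ Hc He He0 Hdisk) as (d & Hd0 & Hd).
  pose proof (taylor_lin _ (-(1)) _ _ _ _ Hd (taylor_const (S N) (phi 0))) as HT.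
  exists (fun k => d k + - (1) * const_coef (phi 0) k)%C.
  assert (E0 : (d O + - (1) * phi 0)%C = 0).
  { rewrite Hd0, (taylor_value_0 _ _ _ Hc). ring. }
  split; [exact E0|]. split.
  { revert HT; apply taylor_ext; intros; [reflexivity|ring]. }
  intros n Hn. apply le_epsilon. intros eps Heps.
  destruct (convex_half_plane _ _ _ (eps / 2) Hconv Hdist ltac:(lra)) as (u & Hu & Hhalf).
  pose proof (taylor_lin _ (- u) _ _ _ _ (taylor_const (S N) (lambda + eps / 2)%R) HT) as HP.
  pose proof (caratheodory _ _ _ n HP) as Hcar. cbn [const_coef] in Hcar.
  rewrite E0 in Hcar.
  destruct n as [|n]; [lia|]. cbn [const_coef] in *.
  replace (0 + - u * (d (S n) + - (1) * 0))%C with (- (u * (d (S n) + - (1) * 0)))%C in Hcar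
    by ring.
  rewrite Cmod_opp, Cmod_mult, Hu in Hcar.
  replace ((lambda + eps / 2)%R + - u * 0)%C with (RtoC (lambda + eps / 2)) in Hcar by ring.
  rewrite re_RtoC in Hcar.
  enough (1 * Cmod (d (S n) + - (1) * 0) <= 2 * (lambda + eps / 2)) by lra.
  apply Hcar; [|exact Hn].
  intros z Hz. pose proof (Hhalf (phi (w z))) as Hh.
  assert (Hin : disk_image phi (phi (w z))) by (exists (w z); auto).
  specialize (Hh Hin). unfold Re in *; simpl in *. lra.
Qed.

Lemma power_series_taylor (N : nat) (a : nat -> C) (h : C -> C) :
  (forall z, disk z -> power_series_sum a z (h z)) -> taylor N a h.
Proof.
  intros Ha. apply taylor_of_power_series with 1; [|lra|exact Ha].
  intros z Hz. destruct (power_series_strict_derivative a h 1 z Ha Hz) as (L & _ & HL).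
  now exists L.
Qed.

Lemma derivative_taylor (N : nat) (a : nat -> C) (h : C -> C) :
  (forall z, disk z -> power_series_sum a z (h z)) -> taylor N (derived a) (C_derive h).
Proof.
  intros Ha. apply power_series_taylor. intros z Hz.
  destruct (power_series_strict_derivative a h 1 z Ha Hz) as (L & HL & HD).
  now rewrite (strict_derivative_C_derive _ _ _ HD).
Qed.

Lemma psum_zero (x : nat -> R) (n : nat) : (forall k, x k = 0) -> psum x n = 0.
Proof. intros H; induction n as [|n IH]; simpl; [|rewrite IH, H]; lra. Qed.

Lemma quasi_subordinate_coef_sums (N : nat) (phi h : C -> C) (a : nat -> C) (lambda r : R) :
  (forall z, disk z -> power_series_sum a z (h z)) ->
  convex_univalent phi ->
  quasi_subordinate (fun z => h z - h 0)%C (fun z => phi z - phi 0)%C ->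
  dist_to (phi 0) (boundary (disk_image phi)) = Finite lambda ->
  0 < r <= 1 / 3 ->
  psum (fun n => Cmod (a (S n)) * r ^ S n) N <= 2 * lambda * (r / (1 - r)) /\
  psum (fun n => Cmod (a (S n)) ^ 2 * r ^ (2 * S n)) N
    <= 4 * lambda ^ 2 * (r ^ 2 / (1 - r ^ 2)).
Proof.
  intros Ha Hphi (Phi & w & [HPhi HPhi1] & Hw & Heq) Hdist Hr.
  pose proof (dist_to_ge_0 _ _ _ Hdist) as Hlam.
  destruct (subordinate_coef_bound N phi w lambda Hphi Hw Hdist) as (d & Hd0 & Hd & Hdb).
  destruct (analytic_taylor (S N) Phi HPhi) as [c Hc].
  pose proof (power_series_taylor (S N) a h Ha) as Hh.
  pose proof (taylor_lin _ (-(1)) _ _ _ _ Hh (taylor_const (S N) (h 0))) as HT.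
  assert (HH : forall z, disk z -> (h z + - (1) * h 0)%C = (Phi z * (phi (w z) - phi 0))%C).
  { intros z Hz. rewrite <- Heq by exact Hz. ring. }
  pose proof (bohr_majorant _ _ _ _ _ _ _ r HT Hc Hd HH HPhi1 ltac:(lra)) as B1.
  pose proof (rogosinski _ _ _ _ _ _ r HT Hd (analytic_holomorphic _ HPhi) HH HPhi1 ltac:(lra)) as B2.
  rewrite !psum_S_l, Hd0, Cmod_0 in B1, B2. cbn [const_coef] in B1, B2.
  assert (E0 : (a O + - (1) * h 0)%C = 0) by (rewrite (taylor_value_0 _ _ _ Hh); ring).
  rewrite E0, Cmod_0 in B1, B2.
  assert (Ek : forall k, Cmod (a (S k) + - (1) * 0) = Cmod (a (S k)))
    by (intros; f_equal; ring).
  assert (Hr2 : 0 <= r ^ 2 < 1) by nra.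
  split.
  - apply Rle_trans with (psum (fun k => Cmod (d (S k)) * r ^ S k) N).
    + erewrite psum_ext; [|intros k; rewrite <- Ek; reflexivity]. lra.
    + eapply Rle_trans; [|apply Rmult_le_compat_l; [lra|apply (psum_geom_le r N); lra]].
      rewrite <- psum_scal. apply psum_le; intros k Hk.
      apply Rmult_le_compat_r; [apply pow_le; lra|]. apply Hdb; lia.
  - apply Rle_trans with (psum (fun k => Cmod (d (S k)) ^ 2 * r ^ (2 * S k)) N).
    + erewrite psum_ext; [|intros k; rewrite <- Ek; reflexivity]. lra.
    + assert (Hl2 : 0 <= 4 * lambda ^ 2) by nra.
      eapply Rle_trans; [|apply Rmult_le_compat_l; [exact Hl2|apply (psum_geom_le (r ^ 2) N Hr2)]].
      rewrite <- psum_scal. apply psum_le; intros k Hk.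
      rewrite pow_mult. apply Rmult_le_compat_r; [apply pow_le; lra|].
      replace (4 * lambda ^ 2) with ((2 * lambda) ^ 2) by ring.
      apply pow_incr; split; [apply Cmod_ge_0|apply Hdb; lia].
Qed.

(** [g' = om h'] with [|om| < 1], so the two sums for the derivatives compare;
    weighting the [n]-th terms by [r/(n+1)] or by its square restores the
    coefficients of [g] and [h]. *)
Lemma coanalytic_coef_sums (N : nat) (h g : C -> C) (a b : nat -> C) (r : R) :
  (forall z, disk z -> power_series_sum a z (h z)) ->
  (forall z, disk z -> power_series_sum b z (g z)) ->
  sense_preserving h g -> 0 < r <= 1 / 3 ->
  psum (fun n => Cmod (b (S n)) * r ^ S n) N
    <= psum (fun n => Cmod (a (S n)) * r ^ S n) N /\
  psum (fun n => Cmod (b (S n)) ^ 2 * r ^ (2 * S n)) N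
    <= psum (fun n => Cmod (a (S n)) ^ 2 * r ^ (2 * S n)) N.
Proof.
  intros Ha Hb Hs Hr.
  set (om := fun z => (C_derive g z * / C_derive h z)%C).
  assert (Hjac : forall z, disk z -> Cmod (C_derive g z) < Cmod (C_derive h z)).
  { intros z Hz. specialize (Hs z Hz). unfold jacobian in Hs.
    pose proof (Cmod_ge_0 (C_derive h z)). pose proof (Cmod_ge_0 (C_derive g z)).
    apply Rnot_le_lt; intros Hle. nra. }
  assert (Hne : forall z, disk z -> C_derive h z <> 0).
  { intros z Hz. apply Cmod_gt_0. pose proof (Cmod_ge_0 (C_derive g z)).
    specialize (Hjac z Hz). lra. }
  assert (Hom1 : forall z, disk z -> Cmod (om z) <= 1).
  { intros z Hz. unfold om. specialize (Hjac z Hz). specialize (Hne z Hz).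
    rewrite Cmod_mult, Cmod_inv by exact Hne. apply Cmod_gt_0 in Hne.
    apply Rle_div_l; lra. }
  assert (Hom : forall z, disk z -> C_derive g z = (om z * C_derive h z)%C).
  { intros z Hz. unfold om. field. auto. }
  assert (HTa : forall M, taylor M (derived a) (C_derive h))
    by (intros; now apply derivative_taylor).
  assert (HTb : forall M, taylor M (derived b) (C_derive g))
    by (intros; now apply derivative_taylor).
  assert (HTo : forall M, exists c, taylor M c om).
  { intros M. destruct (taylor_inv M _ _ (HTa M) Hne) as [e He].
    eexists. apply taylor_mult; [apply HTb|exact He]. }
  assert (Hholo : holomorphic om) by (destruct (HTo O) as [c Hc]; exact Hc).
  assert (Hmod : forall (c : nat -> C) k, Cmod (derived c k) = INR (S k) * Cmod (c (S k))).
  { intros c k. unfold derived. rewrite Cmod_mult, Cmod_R, Rabs_right; [reflexivity|].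
    apply Rle_ge, pos_INR. }
  assert (HS : forall k, 0 < INR (S k)) by (intros; apply (lt_INR 0); lia).
  assert (Hinv : forall k, 0 < / INR (S (S k)) <= / INR (S k)).
  { intros k. split; [apply Rinv_0_lt_compat, HS|].
    apply Rinv_le_contravar; [apply HS|apply le_INR; lia]. }
  split.
  - pose proof (psum_abel (fun k => / INR (S k) * r)
      (fun k => Cmod (derived b k) * r ^ k) (fun k => Cmod (derived a k) * r ^ k) N) as H.
    assert (Ew : forall (c : nat -> C) k,
      / INR (S k) * r * (Cmod (derived c k) * r ^ k) = Cmod (c (S k)) * r ^ S k).
    { intros c k. rewrite Hmod. specialize (HS k). cbn [pow]. field. lra. }
    cbv beta in H. rewrite (psum_ext _ _ N (Ew b)), (psum_ext _ _ N (Ew a)) in H. apply H.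
    + intros k. specialize (Hinv k). nra.
    + intros M. destruct (HTo M) as [c Hc].
      apply bohr_majorant with c (C_derive g) om (C_derive h); auto; lra.
  - pose proof (psum_abel (fun k => (/ INR (S k) * r) ^ 2)
      (fun k => Cmod (derived b k) ^ 2 * r ^ (2 * k))
      (fun k => Cmod (derived a k) ^ 2 * r ^ (2 * k)) N) as H.
    assert (Ew : forall (c : nat -> C) k,
      (/ INR (S k) * r) ^ 2 * (Cmod (derived c k) ^ 2 * r ^ (2 * k))
      = Cmod (c (S k)) ^ 2 * r ^ (2 * S k)).
    { intros c k. rewrite Hmod, !pow_mult. specialize (HS k). cbn [pow]. field. lra. }
    cbv beta in H. rewrite (psum_ext _ _ N (Ew b)), (psum_ext _ _ N (Ew a)) in H. apply H.
    + intros k. specialize (Hinv k). split; [apply pow2_ge_0|].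
      apply pow_incr. split; [apply Rmult_le_pos; lra|apply Rmult_le_compat_r; lra].
    + intros M. apply rogosinski with (C_derive g) om (C_derive h); auto; lra.
Qed.

(** * The bound for [T] and the two radii *)

Lemma T_bound (phi f h g : C -> C) (a b : nat -> C) (lambda r : R) :
  admissible phi f h g a b lambda -> lambda < 2 -> 0 <= r <= 1 / 3 ->
  T a b lambda r <= 4 * lambda * (r / (1 - r))
    + (1 / (2 - lambda) + r / (1 - r)) * (8 * lambda ^ 2 * (r ^ 2 / (1 - r ^ 2))).
Proof.
  intros ((_ & _ & Ha & Hb & _ & Hs) & Hphi & Hq & Hdist) Hl Hr.
  pose proof (dist_to_ge_0 _ _ _ Hdist) as Hlam.
  assert (Hnn : forall (c : nat -> C) p k m, 0 <= Cmod (c k) ^ p * r ^ m).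
  { intros. apply Rmult_le_pos; apply pow_le; [apply Cmod_ge_0|lra]. }
  assert (Hbound : forall N,
    psum (fun n => (Cmod (a (S n)) + Cmod (b (S n))) * r ^ S n) N <= 4 * lambda * (r / (1 - r)) /\
    psum (fun n => (Cmod (a (S n)) ^ 2 + Cmod (b (S n)) ^ 2) * r ^ (2 * S n)) N
      <= 8 * lambda ^ 2 * (r ^ 2 / (1 - r ^ 2))).
  { intros N. destruct (Rle_lt_or_eq_dec 0 r) as [Hr0|<-]; [lra| |].
    - destruct (quasi_subordinate_coef_sums N phi h a lambda r Ha Hphi Hq Hdist ltac:(lra))
        as [A1 A2].
      destruct (coanalytic_coef_sums N h g a b r Ha Hb Hs ltac:(lra)) as [B1 B2].
      split.
      + rewrite (psum_ext _ (fun n => Cmod (a (S n)) * r ^ S n + Cmod (b (S n)) * r ^ S n))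
          by (intros; ring). rewrite psum_plus. lra.
      + rewrite (psum_ext _ (fun n => Cmod (a (S n)) ^ 2 * r ^ (2 * S n)
                                     + Cmod (b (S n)) ^ 2 * r ^ (2 * S n)))
          by (intros; ring). rewrite psum_plus. lra.
    - split; rewrite psum_zero; try (intros; rewrite pow_i by lia; ring).
      + unfold Rdiv; lra.
      + rewrite pow_i by lia. unfold Rdiv; lra. }
  unfold T. apply Rplus_le_compat.
  - apply Series_le_of_psum_le; [|intros N; apply Hbound].
    intros k. apply Rmult_le_pos; [|apply pow_le; lra].
    pose proof (Cmod_ge_0 (a (S k))). pose proof (Cmod_ge_0 (b (S k))). lra.
  - apply Rmult_le_compat_l.
    + apply Rplus_le_le_0_compat; apply Rdiv_le_0_compat; lra.
    + apply Series_le_of_psum_le; [|intros N; apply Hbound].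
      intros k. rewrite Rmult_plus_distr_r. apply Rplus_le_le_0_compat; apply Hnn.
Qed.

Definition r0_poly (lambda r : R) : R :=
  8 * r ^ 3 * lambda ^ 2 - (13 * r ^ 3 + 7 * r ^ 2 - 5 * r + 1) * lambda
  + 10 * r ^ 3 - 2 * r ^ 2 - 10 * r + 2.

Definition rstar_poly (r : R) : R := 5 * r ^ 3 - 9 * r ^ 2 - 5 * r + 1.

Lemma T_le_of_r0_poly (phi f h g : C -> C) (a b : nat -> C) (lambda r : R) :
  admissible phi f h g a b lambda -> lambda < 2 -> 0 <= r <= 1 / 3 ->
  0 <= r0_poly lambda r -> T a b lambda r <= lambda.
Proof.
  intros Hadm Hl Hr Hq.
  eapply Rle_trans; [apply (T_bound _ _ _ _ _ _ _ _ Hadm Hl Hr)|].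
  assert (Hlam : 0 <= lambda) by (destruct Hadm as (_ & _ & _ & Hd); exact (dist_to_ge_0 _ _ _ Hd)).
  assert (Hr2 : 0 < 1 - r ^ 2) by nra.
  assert (Hden : 0 < (2 - lambda) * (1 - r) * (1 - r ^ 2))
    by (repeat apply Rmult_lt_0_compat; lra).
  assert (E : lambda - (4 * lambda * (r / (1 - r))
      + (1 / (2 - lambda) + r / (1 - r)) * (8 * lambda ^ 2 * (r ^ 2 / (1 - r ^ 2))))
    = lambda * r0_poly lambda r / ((2 - lambda) * (1 - r) * (1 - r ^ 2)))
    by (unfold r0_poly; field; lra).
  assert (0 <= lambda * r0_poly lambda r / ((2 - lambda) * (1 - r) * (1 - r ^ 2)))
    by (apply Rdiv_le_0_compat; [apply Rmult_le_pos; lra|exact Hden]).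
  lra.
Qed.

Lemma rstar_poly_decreasing (x y : R) :
  0 <= x -> x < y -> y <= 1 -> rstar_poly y < rstar_poly x.
Proof.
  intros Hx Hxy Hy.
  assert (E : rstar_poly x - rstar_poly y
    = (y - x) * (5 + 9 * (x + y) - 5 * (x ^ 2 + x * y + y ^ 2)))
    by (unfold rstar_poly; ring).
  assert (0 < 5 + 9 * (x + y) - 5 * (x ^ 2 + x * y + y ^ 2)) by nra.
  assert (0 < (y - x) * (5 + 9 * (x + y) - 5 * (x ^ 2 + x * y + y ^ 2)))
    by (apply Rmult_lt_0_compat; lra).
  lra.
Qed.

Lemma r0_poly_decreasing (lambda x y : R) :
  0 <= lambda <= 1 -> 0 <= x -> x < y -> y <= 1 / 5 -> r0_poly lambda y < r0_poly lambda x.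
Proof.
  intros Hl Hx Hxy Hy.
  set (B := (10 - 5 * lambda) + (7 * lambda + 2) * (x + y)
    - (8 * lambda ^ 2 - 13 * lambda + 10) * (x ^ 2 + x * y + y ^ 2)).
  assert (E : r0_poly lambda x - r0_poly lambda y = (y - x) * B)
    by (unfold r0_poly, B; ring).
  assert (HB : 0 < B).
  { assert (0 <= (7 * lambda + 2) * (x + y)) by (apply Rmult_le_pos; lra).
    assert (0 <= x ^ 2 + x * y + y ^ 2 <= 3 / 25) by nra.
    assert (8 * lambda ^ 2 - 13 * lambda + 10 <= 10) by nra.
    assert ((8 * lambda ^ 2 - 13 * lambda + 10) * (x ^ 2 + x * y + y ^ 2)
       <= 10 * (x ^ 2 + x * y + y ^ 2)) by (apply Rmult_le_compat_r; lra).
    unfold B; lra. }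
  assert (0 < (y - x) * B) by (apply Rmult_lt_0_compat; lra). lra.
Qed.

(** [rstar_poly] is [r0_poly 1], and the difference carries the factor
    [1 - lambda]. *)
Lemma r0_poly_gt_rstar_poly (lambda r : R) :
  0 <= lambda < 1 -> 0 <= r < 1 / 5 -> rstar_poly r < r0_poly lambda r.
Proof.
  intros Hl Hr.
  assert (E : r0_poly lambda r - rstar_poly r
    = (1 - lambda) * (1 - 5 * r + 7 * r ^ 2 + 5 * r ^ 3 - 8 * r ^ 3 * lambda))
    by (unfold r0_poly, rstar_poly; ring).
  assert (Hr3 : 0 <= r ^ 3) by (apply pow_le; lra).
  assert (r ^ 3 * lambda <= r ^ 3 * 1) by (apply Rmult_le_compat_l; lra).
  assert (3 * r ^ 3 <= 7 * r ^ 2) by nra.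
  assert (0 < 1 - 5 * r + 7 * r ^ 2 + 5 * r ^ 3 - 8 * r ^ 3 * lambda) by lra.
  assert (0 < (1 - lambda) * (1 - 5 * r + 7 * r ^ 2 + 5 * r ^ 3 - 8 * r ^ 3 * lambda))
    by (apply Rmult_lt_0_compat; lra).
  lra.
Qed.

Lemma rstar_exists :
  exists rstar, 15867507 / 100000000 < rstar < 15867509 / 100000000 /\
    Rabs (rstar - 15867508 / 100000000) <= 5 / 1000000000 /\ rstar_poly rstar = 0.
Proof.
  set (p := 15867508 / 100000000 - 5 / 1000000000).
  set (q := 15867508 / 100000000 + 5 / 1000000000).
  destruct (IVT_cor rstar_poly p q) as [z [Hz Ez]].
  - unfold rstar_poly; intros x; reg.
  - unfold p, q; lra.
  - assert (0 < rstar_poly p) by (unfold rstar_poly, p; lra).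
    assert (rstar_poly q < 0) by (unfold rstar_poly, q; lra). nra.
  - unfold p, q in Hz. exists z. split; [lra|]. split; [apply Rabs_le; lra|exact Ez].
Qed.

Lemma r0_exists (lambda rstar : R) :
  0 < lambda < 1 -> 0 < rstar < 1 / 5 -> rstar_poly rstar = 0 ->
  exists r0, rstar < r0 < 1 / 5 /\ r0_poly lambda r0 = 0.
Proof.
  intros Hl Hr Hp.
  pose proof (r0_poly_gt_rstar_poly lambda rstar ltac:(lra) ltac:(lra)) as H1.
  assert (H2 : r0_poly lambda (1 / 5) < 0) by (unfold r0_poly; nra).
  destruct (IVT_cor (r0_poly lambda) rstar (1 / 5)) as [z [Hz Ez]].
  - unfold r0_poly; intros x; reg.
  - lra.
  - nra.
  - exists z. split; [|exact Ez].
    assert (z <> rstar) by (intros ->; lra). assert (z <> 1 / 5) by (intros ->; lra). lra.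
Qed.

Theorem theorem3 :
  exists rstar : R,
    unique (fun r : R => 0 < r < 1 /\ rstar_equation r) rstar /\
    Rabs (rstar - 15867508 / 100000000) <= 5 / 1000000000 /\
    (forall (phi f h g : C -> C) (a b : nat -> C) (lambda : R),
       admissible phi f h g a b lambda -> lambda < 1 ->
       forall r : R, 0 <= r <= rstar -> T a b lambda r <= lambda) /\
    (forall lambda : R, 0 < lambda < 1 ->
       exists r0 : R,
         unique (fun r : R => rstar < r < 1 / 5 /\ r0_equation lambda r) r0 /\
         forall (phi f h g : C -> C) (a b : nat -> C),
           admissible phi f h g a b lambda ->
           forall r : R, 0 <= r <= r0 -> T a b lambda r <= lambda).
Proof.
  destruct rstar_exists as (rstar & Hbox & Happrox & Hroot).
  exists rstar. split; [|split; [exact Happrox|split]].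
  - split; [split; [lra|exact Hroot]|].
    intros r [Hr Hr0]. change (rstar_poly r = 0) in Hr0.
    destruct (Rtotal_order rstar r) as [H|[H|H]]; [|exact H|].
    + pose proof (rstar_poly_decreasing rstar r). lra.
    + pose proof (rstar_poly_decreasing r rstar). lra.
  - intros phi f h g a b lambda Hadm Hl r Hr.
    assert (Hlam : 0 <= lambda)
      by (destruct Hadm as (_ & _ & _ & Hd); exact (dist_to_ge_0 _ _ _ Hd)).
    apply (T_le_of_r0_poly _ _ _ _ _ _ _ _ Hadm); [lra|lra|].
    pose proof (r0_poly_gt_rstar_poly lambda r ltac:(lra) ltac:(lra)) as H.
    assert (0 <= rstar_poly r).
    { destruct (Rle_lt_or_eq_dec r rstar) as [Hlt| ->]; [lra| |lra].
      pose proof (rstar_poly_decreasing r rstar). lra. }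
    lra.
  - intros lambda Hl.
    destruct (r0_exists lambda rstar Hl ltac:(lra) Hroot) as (r0 & Hr0 & E0).
    exists r0. split.
    + split; [split; [exact Hr0|exact E0]|].
      intros r [Hr Er]. change (r0_poly lambda r = 0) in Er.
      destruct (Rtotal_order r0 r) as [H|[H|H]]; [|exact H|].
      * pose proof (r0_poly_decreasing lambda r0 r). lra.
      * pose proof (r0_poly_decreasing lambda r r0). lra.
    + intros phi f h g a b Hadm r Hr.
      apply (T_le_of_r0_poly _ _ _ _ _ _ _ _ Hadm); [lra|lra|].
      destruct (Rle_lt_or_eq_dec r r0) as [Hlt| ->]; [lra| |lra].
      pose proof (r0_poly_decreasing lambda r r0). lra.
Qed.
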